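(* Let $\nu,\mu\in\mathbb{N}_0$ with $\mu-\nu\in\mathbb{N}_0$, let $n\geq 1$ and $\omega>0$. Let $\{x_j,w_j\}_{j=1}^n$ be the nodes and weights of the $n$-point Gaussian quadrature rule with respect to the weight $w_{\mu,\nu}$ on $(0,\infty)$. Let $\kappa=\mu$ if $\mu-\nu$ is even and $\kappa=\mu+1$ if $\mu-\nu$ is odd. For a function $f$ that is analytic in the right half-plane $\Re(z)\geq 0$ (including at $z=0$) and satisfies $|f(z)|\leq\mathcal{K}|z|^{\sigma}$ for some $\mathcal{K}>0$ and some $\sigma\in\mathbb{R}$ as $z\to\infty$ in this half-plane, define $$(\mathcal{Q}_{2n,\mu}f)(\omega)=\frac{1}{\omega}\left(\sum_{k=0}^{\mu-1}\frac{\hat{w}_k^{0}}{\omega^{k}}f^{(k)}(0)+\sum_{j=1}^{2n}\hat{w}_j\, f\!\left(\frac{\hat{x}_j}{\omega}\right)\right),$$ where the nodes are $\{\hat{x}_j\}_{j=1}^{2n}=\{\pm\mathrm{i}\sqrt{x_j}\}_{j=1}^{n}$, the weight $\hat w$ attached to the node $\pm\mathrm{i}\sqrt{x_j}$ is (with corresponding signs) $$\exp\left(\mp\frac{\nu\pi\mathrm{i}}{2}\right)\frac{w_j\,x_j^{-\kappa/2}}{\pi},$$ and for $k=0,\ldots,\mu-1$, $$\hat{w}_k^{0}=\frac{1}{k!}\left(2^{k}\,\frac{\Gamma((\nu+k+1)/2)}{\Gamma((\nu-k+1)/2)}-\frac{2}{\pi}\cos\left(\frac{(k-\nu)\pi}{2}\right)\sum_{j=1}^{n}w_j\,x_j^{(k-\kappa)/2}\right).$$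 Then this quadrature rule for the Hankel transform $(\mathcal{H}_\nu f)(\omega)=\int_0^\infty f(x)J_\nu(\omega x)\,\mathrm{d}x$ is exact, i.e. $(\mathcal{Q}_{2n,\mu}f)(\omega)=(\mathcal{H}_\nu f)(\omega)$, for all polynomials $f$ of degree at most $4n+\mu-1$ when $\mu-\nu$ is even, and for all polynomials $f$ of degree at most $4n+\mu$ when $\mu-\nu$ is odd.
   Context: $\mathbb{N}_0$ is the set of nonnegative integers. $J_\nu$ is the Bessel function of the first kind and $K_\nu$ the modified Bessel function of the second kind. Every improper integral $\int_0^\infty g(x)\,\mathrm{d}x$ is defined as its Abel limit $\lim_{s\to0^+}\int_0^\infty g(x)e^{-sx}\,\mathrm{d}x$; this applies in particular to $(\mathcal{H}_\nu f)(\omega)$. The reciprocal gamma function $1/\Gamma$ is taken to be $0$ at nonpositive integers. The weight function is, for $x>0$, $$w_{\mu,\nu}(x)=\frac{K_\nu(\sqrt{x})}{2}\cdot\begin{cases}x^{(\mu-1)/2},&\mu-\nu\text{ even},\\ x^{\mu/2},&\mu-\nu\text{ odd},\end{cases}$$ which is positive on $(0,\infty)$ with finite moments. The $n$-point Gaussian quadrature rule with respect to $w_{\mu,\nu}$ is the unique rule with nodes $x_1,\dots,x_n\in(0,\infty)$ and weights $w_1,\dots,w_n>0$ such that $\int_0^\infty w_{\mu,\nu}(x)g(x)\,\mathrm{d}x=\sum_{j=1}^n w_jg(x_j)$ for all polynomials $g$ of degree at most $2n-1$; its nodes are the zeros of the degree-$n$ monic orthogonal polynomial with respect to $w_{\mu,\nu}$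 on $(0,\infty)$. *)

(* Defs.v *)
From HB Require Import structures.
From mathcomp Require Import all_boot all_order all_algebra.
From mathcomp Require Import complex.
From mathcomp Require Import all_classical all_reals all_analysis.

Set Implicit Arguments.
Unset Strict Implicit.
Unset Printing Implicit Defensive.
Import Order.TTheory GRing.Theory Num.Theory numFieldNormedType.Exports.
Local Open Scope classical_set_scope.
Local Open Scope ring_scope.

Definition besselJ (R : realType) (nu : nat) (x : R) : R :=
  limn (series (fun m : nat =>
    (-1) ^+ m / (m`! * (m + nu)`!)%:R * (x / 2) ^+ (2 * m + nu))).

Definition cosh (R : realType) (t : R) : R := (expR t + expR (- t)) / 2.

(* K_nu(x) = int_0^oo exp(- x cosh t) cosh(nu t) dt; only used for 0 < x. *)
Definition besselK (R : realType) (nu : nat) (x : R) : R :=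
  \int[@lebesgue_measure R]_(t in `]0, +oo[)
    (expR (- (x * cosh t)) * cosh (nu%:R * t)).

Definition euler_integral (R : realType) (x : R) : R :=
  \int[@lebesgue_measure R]_(t in `]0, +oo[) (t `^ (x - 1) * expR (- t)).

(* For x <= 0 the Gamma function is extended by
   Gamma(x) = Gamma(x + m) / (x (x + 1) ... (x + m - 1)), with m the least
   natural number such that 0 < x + m. At a nonpositive integer the
   denominator vanishes, so Gamma x = 0 there, hence also (Gamma x)^-1 = 0:
   the inverse of Gamma is the reciprocal gamma function everywhere. *)
Definition Gamma (R : realType) (x : R) : R :=
  if 0 < x then euler_integral x
  else let m := (Num.truncn (- x)).+1 in
       euler_integral (x + m%:R) / \prod_(i < m) (x + i%:R).

(* The improper integral of g over (0, +oo) is by convention its Abel limit,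
   l = lim_(s -> 0+) int_0^oo g(x) exp(- s x) dx. *)
Definition is_abel_integral (R : realType) (g : R -> R) (l : R) : Prop :=
  (forall s : R, 0 < s ->
     (@lebesgue_measure R).-integrable `]0, +oo[
       (fun x : R => (g x * expR (- (s * x)))%:E)) /\
  (\int[@lebesgue_measure R]_(x in `]0, +oo[) (g x * expR (- (s * x))))
    @[s --> (0 : R)^'+] --> l.

Definition is_cabel_integral (R : realType) (g : R -> R[i]) (l : R[i]) : Prop :=
  is_abel_integral (fun x => complex.Re (g x)) (complex.Re l) /\
  is_abel_integral (fun x => complex.Im (g x)) (complex.Im l).

(* [is_hankel_transform nu f omega l]: (H_nu f)(omega) exists and equals l. *)
Definition is_hankel_transform (R : realType) (nu : nat) (f : R[i] -> R[i])
    (omega : R) (l : R[i]) : Prop :=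
  is_cabel_integral
    (fun x : R => f (real_complex R x) *
                  real_complex R (besselJ nu (omega * x))) l.

Definition gauss_weight (R : realType) (mu nu : nat) (x : R) : R :=
  besselK nu (Num.sqrt x) / 2 *
  (if odd (mu - nu) then x `^ (mu%:R / 2) else x `^ ((mu%:R - 1) / 2)).

Definition is_gauss_rule (R : realType) (W : R -> R) (n : nat)
    (x w : 'I_n -> R) : Prop :=
  [/\ injective x,
      forall j, 0 < x j,
      forall j, 0 < w j &
      forall g : {poly R}, (size g <= (2 * n - 1).+1)%N ->
        is_abel_integral (fun t => W t * g.[t]) (\sum_(j < n) w j * g.[x j])].

Definition kappa (mu nu : nat) : nat := if odd (mu - nu) then mu.+1 else mu.

Definition cis (R : realType) (t : R) : R[i] := (cos t +i* sin t)%C.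

(* The 2n nodes and weights are indexed by pairs (j, b): the sign of
   +- i sqrt(x_j) is (-1) ^+ b. *)
Definition hnode (R : realType) (n : nat) (x : 'I_n -> R)
    (j : 'I_n) (b : bool) : R[i] :=
  (0 +i* ((-1) ^+ b * Num.sqrt (x j)))%C.

Definition hweight (R : realType) (mu nu n : nat) (x w : 'I_n -> R)
    (j : 'I_n) (b : bool) : R[i] :=
  cis (- ((-1) ^+ b * (nu%:R * pi / 2))) *
  real_complex R (w j * x j `^ (- ((kappa mu nu)%:R / 2)) / pi).

Definition hweight0 (R : realType) (mu nu n : nat) (x w : 'I_n -> R)
    (k : nat) : R :=
  (k`!%:R)^-1 *
  (2 ^+ k * (Gamma ((nu%:R + k%:R + 1) / 2) / Gamma ((nu%:R - k%:R + 1) / 2))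
   - 2 / pi * cos ((k%:R - nu%:R) * pi / 2) *
     \sum_(j < n) w j * x j `^ ((k%:R - (kappa mu nu)%:R) / 2)).

(* The derivatives are complex ones; the ^o gives the codomain its structure
   of normed module over R[i]. *)
Definition hankel_quad (R : realType) (mu nu n : nat) (x w : 'I_n -> R)
    (f : R[i] -> R[i]) (omega : R) : R[i] :=
  (real_complex R omega)^-1 *
  (\sum_(k < mu) real_complex R (hweight0 mu nu x w k / omega ^+ k) *
                 (derive1n k (f : R[i] -> R[i]^o) 0 : R[i])
   + \sum_(j < n) \sum_(b : bool)
       hweight mu nu x w j b * f (hnode x j b / real_complex R omega)).

(* Main.v *)
Require Import Defs.
From HB Require Import structures.
From mathcomp Require Import all_boot all_order all_algebra.
From mathcomp Require Import complex.
From mathcomp Require Import all_classical all_reals all_analysis.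
From mathcomp Require Import measurable_realfun zify ring lra.
Import Order.TTheory GRing.Theory Num.Theory numFieldNormedType.Exports.
Local Open Scope classical_set_scope.
Local Open Scope ring_scope.
Set Implicit Arguments.
Unset Strict Implicit.
Unset Printing Implicit Defensive.

(* Everything is linear in f, so let f be the monomial x^k. Two families of
   numbers are computed and compared through two-term recurrences.

   Bessel side: set A_{k,nu}(s) = int_0^oo x^k J_nu(omega x) e^{-sx} dx. Since
   x J_nu'(x) = nu J_nu(x) - x J_{nu+1}(x) and
   x J_{nu+1}'(x) = x J_nu(x) - (nu+1) J_{nu+1}(x), integrating by parts gives
     omega A_{k+1,nu+1} + s A_{k+1,nu} = (nu+k+1) A_{k,nu},
     omega A_{k+1,nu} - s A_{k+1,nu+1} = (nu-k) A_{k,nu+1}.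
   The determinant omega^2 + s^2 does not vanish at s = 0, so the limits at 0+
   exist for all k once they do for k = 0, where they follow from
   A_{0,0}(s) = (omega^2 + s^2)^{-1/2}. The limits M_{k,nu} / omega^{k+1} satisfy
     M_{k+1,nu+1} = (nu+k+1) M_{k,nu},  M_{k+1,0} = - k M_{k,1},
   as does 2^k Gamma((nu+k+1)/2) / Gamma((nu-k+1)/2).

   Quadrature side: the node part of the rule at x^k is a cosine times
   sum_j w_j x_j^l with k = kappa + 2l. Gauss exactness, Tonelli and the
   substitution t = u^2 turn this sum into
   k! int_0^oo cosh(nu t) / cosh(t)^{k+1} dt, whose recurrences (again by parts)
   are those of M up to sign. If k - nu is odd, both sides vanish. *)

(** * Improper integrals over the half-line *)

Section improper_FTC.
Context {R : realType}.
Notation mu := (@lebesgue_measure R).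
Implicit Types (f F : R -> R) (a b l : R).

(** Compact intervals that increase to the open half-line. The right end is [n + 2], so that the
    interval is nondegenerate already at [n = 0]. *)
Let B (n : nat) : set R := `[n.+1%:R^-1, n.+2%:R].

Let B_gt0 n x : B n x -> 0 < x.
Proof.
rewrite /B/= in_itv/= => /andP[+ _]; apply: lt_le_trans.
by rewrite invr_gt0.
Qed.

Let nd_B : nondecreasing_seq B.
Proof.
apply/nondecreasing_seqP => n; apply/subsetPset => x.
rewrite /B/= !in_itv/= => /andP[h1 h2]; apply/andP; split.
  by apply: le_trans h1; rewrite lef_pV2 ?posrE// ler_nat.
by apply: (le_trans h2); rewrite ler_nat.
Qed.

Let mem_B (x : R) : 0 < x -> \forall n \near \oo, B n x.
Proof.
move=> x0; near=> n; rewrite /B/= in_itv/=; apply/andP; split.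
  rewrite invf_ple ?posrE//.
  have : x^-1 < n%:R by near: n; exact: nbhs_infty_gtr.
  by move/ltW/le_trans; apply; rewrite ler_nat.
have : x < n%:R by near: n; exact: nbhs_infty_gtr.
by move/ltW/le_trans; apply; rewrite ler_nat leqW.
Unshelve. all: end_near. Qed.

Let bigcup_B : \bigcup_n B n = `]0, +oo[%classic.
Proof.
apply/seteqP; split=> [x [n _]|x].
  by move=> /B_gt0; rewrite /= in_itv/= andbT.
rewrite /= in_itv/= andbT => /mem_B[N _ /(_ N (leqnn N)) h].
by exists N.
Qed.

Variables (f F : R -> R) (l0 l : R).
Hypothesis cf : forall x : R, 0 < x -> {for x, continuous f}.
Hypothesis dF : forall x : R, 0 < x -> is_derive x 1 F (f x).
Hypothesis F0 : F x @[x --> 0^'+] --> l0.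
Hypothesis Fl : F x @[x --> +oo] --> l.

Let integral_B n :
  (\int[mu]_(x in B n) (f x)%:E = (F n.+2%:R - F n.+1%:R^-1)%:E)%E.
Proof.
have n0 : 0 < n.+1%:R^-1 :> R by rewrite invr_gt0.
have cF (x : R) : 0 < x -> {for x, continuous F}.
  by move=> x0; apply/differentiable_continuous/derivable1_diffP; have [] := dF x0.
have nn : n.+1%:R^-1 < n.+2%:R :> R.
  by rewrite (@le_lt_trans _ _ 1) ?invf_le1 ?ler1n ?ltr1n.
rewrite EFinB; apply: continuous_FTC2 => //.
- apply: continuous_in_subspaceT => x; rewrite inE => /(@B_gt0 n) x0; exact: cf.
- split.
  + move=> x; rewrite in_itv/= => /andP[nx _].
    by have [] := dF (lt_trans n0 nx).
  + exact/cvg_at_right_filter/cF.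
  + exact/cvg_at_left_filter/cF.
- move=> x; rewrite in_itv/= => /andP[nx _].
  by rewrite derive1E; have := dF (lt_trans n0 nx) => ?; exact: derive_val.
Qed.

Let cvg_F_B : (F n.+2%:R - F n.+1%:R^-1)%:E @[n --> \oo] --> (l - l0)%:E.
Proof.
apply: cvg_EFin; first exact: nearW.
apply: cvgB.
  have : (n.+2%:R : R) @[n --> \oo] --> +oo.
    apply/cvgryPge => A; near=> n; apply: (@le_trans _ _ n%:R).
      by near: n; exact: nbhs_infty_ger.
    by rewrite ler_nat -addn2 leq_addr.
  by move=> /cvg_comp; apply; exact: Fl.
have /cvg_at_rightP := F0.
apply; split; first by move=> n; rewrite invr_gt0.
exact: cvg_harmonic.
Unshelve. all: end_near. Qed.

Let mf : measurable_fun (`]0, +oo[ : set R) f.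
Proof.
apply: open_continuous_measurable_fun => //.
by move=> x; rewrite inE/= in_itv/= andbT; exact: cf.
Qed.

Let B_sub n : B n `<=` `]0, +oo[.
Proof. by move=> x /B_gt0; rewrite /= in_itv/= andbT. Qed.

(** Monotone convergence along the [B n], so that integrability is a conclusion, drawn in the next
    lemma from the finite value. *)
Lemma ge0_FTC2_0y : (forall x : R, 0 < x -> 0 <= f x) ->
  (\int[mu]_(x in `]0%R, +oo[) (f x)%:E = (l - l0)%:E)%E.
Proof.
move=> f0; have mfB n : measurable_fun (B n) (EFin \o f).
  by apply/measurable_EFinP; apply: measurable_funS mf => //; exact: B_sub.
have f0B n x : B n x -> (0 <= (EFin \o f) x)%E.
  by move=> /B_gt0 x0; rewrite lee_fin f0.
have mB n : measurable (B n) by exact: measurable_itv.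
have := @ge0_nondecreasing_set_cvg_integral _ (measurableTypeR R) R B (EFin \o f) lebesgue_measure nd_B mB mfB f0B.
rewrite bigcup_B; under eq_fun do rewrite integral_B.
by move/cvg_unique; apply => //; exact: cvg_F_B.
Qed.

Lemma ge0_FTC2_0y_integrable : (forall x : R, 0 < x -> 0 <= f x) ->
  mu.-integrable `]0, +oo[ (EFin \o f).
Proof.
move=> f0; apply/integrableP; split; first exact/measurable_EFinP.
under eq_integral => x.
  rewrite inE/= in_itv/= andbT => x0.
  rewrite ger0_norm; last exact: f0.
  over.
by rewrite ge0_FTC2_0y// ltry.
Qed.

(** For integrands of any sign, dominated convergence along the [B n] with [|f|] as the bound. The
    integrations by parts below are instances, with [l0] and [l] as boundary values. *)
Lemma integrable_FTC2_0y : mu.-integrable `]0, +oo[ (EFin \o f) ->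
  \int[mu]_(x in `]0, +oo[) f x = l - l0.
Proof.
move=> intf; rewrite /Rintegral.
have mB n : measurable (B n) by exact: measurable_itv.
have -> : (\int[mu]_(x in `]0%R, +oo[) (f x)%:E = (l - l0)%:E)%E; last by [].
have [||||||_ _] := @dominated_convergence _ _ R mu `]0, +oo[ _
    (fun n => (EFin \o f) \_ (B n)) (EFin \o f) (abse \o (EFin \o f)).
- by [].
- move=> n; apply/(measurable_restrict _ (mB n)) => //.
  apply/measurable_EFinP.
  by apply: measurable_funS mf => //; exact: subIsetl.
- exact/measurable_EFinP.
- apply: aeW => x; rewrite /= in_itv/= andbT => /mem_B nB.
  apply: cvg_near_cst; near=> n; rewrite patchE ifT// inE.
  by near: n.
- exact: integrable_abse.
- apply: aeW => x n _; rewrite patchE; case: ifP => //= _.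
  by rewrite normr0 lee_fin.
rewrite (_ : [sequence _]_n = fun n => (F n.+2%:R - F n.+1%:R^-1)%:E).
  by move/cvg_unique; apply => //; exact: cvg_F_B.
apply/funext => n; rewrite /= -integral_B -integral_mkcondr.
by rewrite setIidr//; exact: B_sub.
Unshelve. all: end_near. Qed.

End improper_FTC.

Section half_line_integrals.
Context {R : realType}.
Notation mu := (@lebesgue_measure R).
Implicit Types (f g : R -> R) (r t : R).

Lemma measurable_half_line f : (forall t, 0 < t -> {for t, continuous f}) ->
  measurable_fun (`]0, +oo[ : set R) f.
Proof.
move=> cf; apply: open_continuous_measurable_fun => //.
by move=> x; rewrite inE/= in_itv/= andbT; exact: cf.
Qed.

Lemma integrable_half_lineZ r f : mu.-integrable `]0, +oo[ (EFin \o f) ->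
  mu.-integrable `]0, +oo[ (EFin \o (fun t => r * f t)).
Proof.
move=> intf.
have mD : measurable (`]0%R, +oo[ : set (measurableTypeR R)) by exact: measurable_itv.
by apply: eq_integrable (integrableZl mD r intf).
Qed.

Lemma integrable_half_lineD f g : mu.-integrable `]0, +oo[ (EFin \o f) ->
  mu.-integrable `]0, +oo[ (EFin \o g) ->
  mu.-integrable `]0, +oo[ (EFin \o (fun t => f t + g t)).
Proof.
move=> intf intg.
have mD : measurable (`]0%R, +oo[ : set (measurableTypeR R)) by exact: measurable_itv.
by apply: eq_integrable (integrableD mD intf intg).
Qed.

Lemma integrable_half_lineB f g : mu.-integrable `]0, +oo[ (EFin \o f) ->
  mu.-integrable `]0, +oo[ (EFin \o g) ->
  mu.-integrable `]0, +oo[ (EFin \o (fun t => f t - g t)).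
Proof.
move=> intf intg.
have mD : measurable (`]0%R, +oo[ : set (measurableTypeR R)) by exact: measurable_itv.
by apply: eq_integrable (integrableB mD intf intg).
Qed.

Lemma le_integrable_half_line f g : measurable_fun (`]0, +oo[ : set R) f ->
  (forall t, 0 < t -> `|f t| <= g t) -> mu.-integrable `]0, +oo[ (EFin \o g) ->
  mu.-integrable `]0, +oo[ (EFin \o f).
Proof.
move=> mf fg; apply: le_integrable => //; first exact/measurable_EFinP.
move=> t; rewrite /= in_itv/= andbT => t0; rewrite lee_fin.
by rewrite (le_trans (fg _ t0))// ler_norm.
Qed.

Lemma le_integral_half_line f g : mu.-integrable `]0, +oo[ (EFin \o f) ->
  mu.-integrable `]0, +oo[ (EFin \o g) -> (forall t, 0 < t -> f t <= g t) ->
  \int[mu]_(t in `]0, +oo[) f t <= \int[mu]_(t in `]0, +oo[) g t.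
Proof.
move=> intf intg fg; apply: le_Rintegral => // t.
by rewrite /= in_itv/= andbT; exact: fg.
Qed.

Lemma eq_integral_half_line f g : (forall t, 0 < t -> f t = g t) ->
  \int[mu]_(t in `]0, +oo[) f t = \int[mu]_(t in `]0, +oo[) g t.
Proof.
by move=> fg; apply: eq_Rintegral => t; rewrite inE/= in_itv/= andbT; exact: fg.
Qed.

Lemma eq_integrable_half_line f g : (forall t, 0 < t -> f t = g t) ->
  mu.-integrable `]0, +oo[ (EFin \o f) -> mu.-integrable `]0, +oo[ (EFin \o g).
Proof.
move=> fg; apply: eq_integrable => // t; rewrite inE/= in_itv/= andbT => t0.
by rewrite fg.
Qed.

End half_line_integrals.

(* The library instance for powers is stated for [f ^+ n] in the ring of
   functions, which does not unify with [fun y => f y ^+ n]. *)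
#[global] Instance is_derive_exprn {R : realType} (f : R -> R) n (x df : R) :
  is_derive x 1 f df ->
  is_derive x 1 (fun y => f y ^+ n) (n%:R * f x ^+ n.-1 * df).
Proof.
move=> dfx; rewrite (_ : (fun y => f y ^+ n) = f ^+ n); first exact: is_deriveX.
by apply/funext => y; rewrite exprfctE.
Qed.

(** * Moments of the exponential on the half-line *)

Section exponential_moments.
Context {R : realType}.
Notation mu := (@lebesgue_measure R).
Implicit Types (c x u t s : R) (k n : nat).

Lemma ler_exprn_expR k x : 0 <= x -> x ^+ k <= k`!%:R * expR x.
Proof.
move=> x0; case: k => [|k]; first by rewrite expr0 fact0 mul1r -expR0 ler_expR.
have := expR_ge1Dxn k x0; rewrite -ler_pdivrMl ?ltr0n ?fact_gt0//.
by rewrite mulrC; apply: le_trans; rewrite lerDr.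
Qed.

Lemma cvgy_exprn_expRN k c : 0 < c -> u ^+ k * expR (- (c * u)) @[u --> +oo] --> 0.
Proof.
(* The exponential bound of degree [k + 1] at [c * u] gives [u ^+ k * expR (- (c * u)) <= K / u],
   which tends to 0. *)
move=> c0; pose K := k.+1`!%:R / c ^+ k.+1.
have invy : (u : R)^-1 @[u --> +oo] --> 0.
  by apply/gtr0_cvgV0 => //; exact: nbhs_pinfty_gt.
have : K * u^-1 @[u --> +oo] --> K * 0 by apply: cvgM; [exact: cvg_cst|].
rewrite mulr0; apply: squeeze_cvgr; last exact: cvg_cst.
near=> u; have u0 : 0 < u by near: u; exact: nbhs_pinfty_gt.
rewrite mulr_ge0 ?expR_ge0 ?exprn_ge0 ?(ltW u0)//= expRN /K.
rewrite ler_pdivrMr ?expR_gt0// mulrAC -mulrA mulrAC -[leRHS]mulrA.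
have := @ler_exprn_expR k.+1 (c * u) (ltW (mulr_gt0 c0 u0)).
rewrite exprMn => h; rewrite -(ler_pM2l (exprn_gt0 k.+1 c0)) -(ler_pM2l u0).
apply: le_trans (le_trans h _).
  by rewrite le_eqVlt; apply/orP; left; apply/eqP; rewrite mulrCA -exprS.
rewrite le_eqVlt; apply/orP; left; apply/eqP; field.
by rewrite !gt_eqF// exprn_gt0.
Unshelve. all: end_near. Qed.

(** For [0 < c], the antiderivative of [u ^+ k * expR (- (c * u))] that vanishes at infinity; each
    recursive step is one integration by parts. *)
Fixpoint exp_primitive c k u : R :=
  if k is k'.+1 then - u ^+ k * expR (- (c * u)) / c + k%:R / c * exp_primitive c k' u
  else - expR (- (c * u)) / c.

Lemma is_derive_exp_primitive c k u : c != 0 ->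
  is_derive u 1 (exp_primitive c k) (u ^+ k * expR (- (c * u))).
Proof.
move=> c0; elim: k => [|k] /=.
  by apply: trigger_derive; rewrite /GRing.scale/=; field.
move: (exp_primitive c k) => G ih.
apply: trigger_derive; rewrite /GRing.scale/=.
by field.
Qed.

Lemma exp_primitive0 c k : exp_primitive c k 0 = - (k`!%:R / c ^+ k.+1).
Proof.
elim: k => [|k ih] /=; first by rewrite mulr0 oppr0 expR0 fact0 expr1 mulNr.
by rewrite ih expr0n/= oppr0 !mul0r add0r factS natrM !exprS !invfM; ring.
Qed.

Lemma cvgy_exp_primitive c k : 0 < c -> exp_primitive c k u @[u --> +oo] --> 0.
Proof.
move=> c0; elim: k => [|k ih].
  have := cvgy_exprn_expRN 0 c0; under eq_fun do rewrite expr0 mul1r.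
  move=> h; rewrite -(mul0r c^-1) -oppr0 /=.
  by apply: cvgM; [exact: cvgN|exact: cvg_cst].
have : - (u ^+ k.+1 * expR (- (c * u))) / c + k.+1%:R / c * exp_primitive c k u
    @[u --> +oo] --> - 0 / c + k.+1%:R / c * 0.
  apply: cvgD; last by apply: cvgM; [exact: cvg_cst|].
  apply: cvgM; last exact: cvg_cst.
  by apply: cvgN; exact: cvgy_exprn_expRN.
rewrite oppr0 mul0r mulr0 addr0; under eq_fun do rewrite -mulNr.
by [].
Qed.

Lemma continuous_exp_primitive c k : c != 0 -> continuous (exp_primitive c k).
Proof.
move=> c0 u; apply/differentiable_continuous/derivable1_diffP.
by have [] := is_derive_exp_primitive k u c0.
Qed.

Lemma continuous_exprn_expRN c k : continuous (fun u => u ^+ k * expR (- (c * u))).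
Proof.
move=> u; apply/differentiable_continuous/derivable1_diffP.
exact: ex_derive.
Qed.

Lemma integral_exprn_expRN c k : 0 < c ->
  (\int[mu]_(u in `]0%R, +oo[) (u ^+ k * expR (- (c * u)))%:E
   = (k`!%:R / c ^+ k.+1)%:E)%E.
Proof.
move=> c0; transitivity (0 - exp_primitive c k 0)%:E; last first.
  by rewrite exp_primitive0 sub0r opprK.
apply: (@ge0_FTC2_0y _ _ (exp_primitive c k)).
- by move=> u _; exact: continuous_exprn_expRN.
- by move=> u _; apply: is_derive_exp_primitive; rewrite gt_eqF.
- by apply: cvg_at_right_filter; apply: continuous_exp_primitive; rewrite gt_eqF.
- exact: cvgy_exp_primitive.
- by move=> u u0; rewrite mulr_ge0 ?expR_ge0// exprn_ge0// ltW.
Qed.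

Lemma integrable_exprn_expRN c k : 0 < c ->
  mu.-integrable `]0, +oo[ (EFin \o (fun u => u ^+ k * expR (- (c * u)))).
Proof.
move=> c0; apply: (@ge0_FTC2_0y_integrable _ _ (exp_primitive c k) (exp_primitive c k 0) 0).
- by move=> u _; exact: continuous_exprn_expRN.
- by move=> u _; apply: is_derive_exp_primitive; rewrite gt_eqF.
- by apply: cvg_at_right_filter; apply: continuous_exp_primitive; rewrite gt_eqF.
- exact: cvgy_exp_primitive.
- by move=> u u0; rewrite mulr_ge0 ?expR_ge0// exprn_ge0// ltW.
Qed.

End exponential_moments.

(** * The substitution [t = u^2], and the Euler integral at half-integers *)

Section sqrt_moments.
Context {R : realType}.
Notation mu := (@lebesgue_measure R).
Implicit Types (c x u t s : R) (k n : nat).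

Lemma cvgy_sqrt : Num.sqrt (t : R) @[t --> +oo] --> +oo.
Proof.
apply/cvgryPge => A; near=> t.
have [A0|A0] := leP A 0; first by rewrite (le_trans A0)// sqrtr_ge0.
by rewrite -(gtr0_norm A0) -sqrtr_sqr ler_wsqrtr.
Unshelve. all: end_near. Qed.

Lemma continuous_at_sqrt_quot k (g : R -> R) t : 0 < t -> continuous g ->
  {for t, continuous (fun t => Num.sqrt t ^+ k / Num.sqrt t * g t)}.
Proof.
move=> t0 cg; apply: cvgM; last exact: cg.
apply: cvgM; last by apply: cvgV; [rewrite gt_eqF ?sqrtr_gt0|exact: sqrt_continuous].
apply: (@continuous_comp _ _ _ Num.sqrt (fun u => u ^+ k)).
  exact: sqrt_continuous.
exact: exprn_continuous.
Qed.

Lemma continuous_expR_Nsqrt c : continuous (fun t => expR (- (c * Num.sqrt t)) / 2).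
Proof.
move=> t; apply: cvgM; last exact: cvg_cst.
apply: (@continuous_comp _ _ _ (fun t => - (c * Num.sqrt t)) expR).
  by apply: cvgN; apply: cvgM; [exact: cvg_cst|exact: sqrt_continuous].
exact: continuous_expR.
Qed.

Lemma continuous_expRN : continuous (fun t : R => expR (- t)).
Proof.
by move=> t; apply: (@continuous_comp _ _ _ -%R expR); [exact: cvgN|exact: continuous_expR].
Qed.

Let F c k t := exp_primitive c k (Num.sqrt t).

(** The integrand after the substitution: [1 / (2 sqrt t)] is the derivative of [sqrt]. The quotient
    stands for the exponent [k - 1], which is negative at [k = 0]. *)
Let f c k t := Num.sqrt t ^+ k / Num.sqrt t * (expR (- (c * Num.sqrt t)) / 2).

Let dF c k t : c != 0 -> 0 < t -> is_derive t 1 (F c k) (f c k t).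
Proof.
move=> c0 t0; rewrite /F.
have dG : is_derive (Num.sqrt t) 1 (exp_primitive c k) _ := is_derive_exp_primitive k (Num.sqrt t) c0.
have ds : is_derive t 1 Num.sqrt _ := is_derive1_sqrt t0.
apply: (trigger_derive (is_derive1_comp dG ds)).
by rewrite /f/=; field; rewrite gt_eqF// sqrtr_gt0.
Qed.

Let F0 c k : c != 0 -> F c k t @[t --> 0^'+] --> exp_primitive c k 0.
Proof.
move=> c0; have s0 : Num.sqrt t @[t --> 0^'+] --> (0 : R).
  by rewrite -{2}(sqrtr0 R); apply: cvg_at_right_filter; exact: sqrt_continuous.
by apply: (cvg_comp _ _ s0); exact: continuous_exp_primitive.
Qed.

Let Fy c k : 0 < c -> F c k t @[t --> +oo] --> 0.
Proof.
by move=> c0; apply: cvg_comp (cvgy_exp_primitive k c0); exact: cvgy_sqrt.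
Qed.

Let f0 c k t : 0 < t -> 0 <= f c k t.
Proof. by move=> t0; rewrite mulr_ge0// divr_ge0 ?expR_ge0// ?exprn_ge0// sqrtr_ge0. Qed.

Lemma integral_sqrt_expRN c k : 0 < c ->
  (\int[mu]_(t in `]0%R, +oo[)
     (Num.sqrt t ^+ k / Num.sqrt t * (expR (- (c * Num.sqrt t)) / 2))%:E
   = (k`!%:R / c ^+ k.+1)%:E)%E.
Proof.
move=> c0; have c0' : c != 0 by rewrite gt_eqF.
transitivity (0 - exp_primitive c k 0)%:E; last first.
  by rewrite exp_primitive0 sub0r opprK.
apply: (@ge0_FTC2_0y _ _ (F c k)).
- by move=> t t0; apply: continuous_at_sqrt_quot => //; exact: continuous_expR_Nsqrt.
- by move=> t t0; exact: dF.
- exact: F0.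
- exact: Fy.
- by move=> t; exact: f0.
Qed.

Lemma integrable_sqrt_expRN c k : 0 < c ->
  mu.-integrable `]0, +oo[ (EFin \o
     (fun t => Num.sqrt t ^+ k / Num.sqrt t * (expR (- (c * Num.sqrt t)) / 2))).
Proof.
move=> c0; have c0' : c != 0 by rewrite gt_eqF.
apply: (@ge0_FTC2_0y_integrable _ _ (F c k) (exp_primitive c k 0) 0).
- by move=> t t0; apply: continuous_at_sqrt_quot => //; exact: continuous_expR_Nsqrt.
- by move=> t t0; exact: dF.
- exact: F0.
- exact: Fy.
- by move=> t; exact: f0.
Qed.

(** [(sqrt t - 1/2)^2 >= 0] gives [sqrt t <= t + 1/4]. Integrability and decay for [expR (- t)] thus
    follow from those for [expR (- sqrt t)]. *)
Lemma expRN_le_sqrt t : 0 <= t -> expR (- t) <= expR 4^-1 * expR (- Num.sqrt t).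
Proof.
move=> t0; rewrite -expRD ler_expR -{1}(sqr_sqrtr t0).
by have := sqr_ge0 (Num.sqrt t - 2^-1); lra.
Qed.

Let e k t := Num.sqrt t ^+ k / Num.sqrt t * expR (- t).

Let ce k t : 0 < t -> {for t, continuous (e k)}.
Proof.
move=> t0; apply: continuous_at_sqrt_quot => //.
exact: continuous_expRN.
Qed.

Let ie k : mu.-integrable `]0, +oo[ (EFin \o e k).
Proof.
apply: le_integrable_half_line (integrable_half_lineZ (2 * expR 4^-1) (integrable_sqrt_expRN k ltr01)).
  by apply: measurable_half_line => t; exact: ce.
move=> t t0; rewrite /e mul1r.
rewrite ger0_norm ?mulr_ge0 ?invr_ge0 ?exprn_ge0 ?expR_ge0 ?sqrtr_ge0//.
rewrite [leRHS](_ : _ = Num.sqrt t ^+ k / Num.sqrt t * (expR 4^-1 * expR (- Num.sqrt t))); last by field; rewrite gt_eqF// sqrtr_gt0.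
apply: ler_wpM2l; last exact/expRN_le_sqrt/ltW.
by rewrite mulr_ge0 ?invr_ge0 ?exprn_ge0 ?sqrtr_ge0.
Qed.

Lemma powR_half k t : 0 < t -> t `^ ((k%:R - 1) / 2) = Num.sqrt t ^+ k / Num.sqrt t.
Proof.
move=> t0; rewrite -!powR12_sqrt ?ltW// -powR_mulrn ?powR_ge0// -powRrM -powRB; last first.
  by apply/implyP => _; rewrite gt_eqF.
by congr (_ `^ _); field.
Qed.

Lemma euler_integral_half k : euler_integral ((k%:R + 1) / 2 : R) =
  \int[mu]_(t in `]0, +oo[) e k t.
Proof.
apply: eq_integral_half_line => t t0; rewrite /e -powR_half//.
by congr (_ `^ _ * _); field.
Qed.

(** Integrate the derivative of [- t^((k+1)/2) expR (- t)], a function that vanishes at both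
    ends. *)
Lemma euler_integral_half_rec k :
  euler_integral ((k%:R + 1) / 2 + 1 : R) = (k%:R + 1) / 2 * euler_integral ((k%:R + 1) / 2 : R).
Proof.
rewrite (_ : (k%:R + 1) / 2 + 1 = (k.+2%:R + 1) / 2); last by rewrite -addn2 natrD; field.
rewrite !euler_integral_half.
pose G t := - (Num.sqrt t ^+ k.+1 * expR (- t)).
have ig := integrable_half_lineZ ((k%:R + 1) / 2) (ie k).
have : \int[mu]_(t in `]0, +oo[) (e k.+2 t - (k%:R + 1) / 2 * e k t) = 0 - 0.
  apply: (@integrable_FTC2_0y R (fun t => e k.+2 t - (k%:R + 1) / 2 * e k t) G).
  - move=> t t0; apply: cvgB; first exact: ce.
    by apply: cvgM; [exact: cvg_cst|exact: ce].
  - move=> t t0; have ds : is_derive t 1 Num.sqrt _ := is_derive1_sqrt t0.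
    apply: trigger_derive; rewrite /GRing.scale/= /e !exprS -!natr1.
    by field; rewrite gt_eqF// sqrtr_gt0.
  - rewrite -[X in _ --> X](_ : G 0 = 0); last first.
      by rewrite /G sqrtr0 expr0n/= mul0r oppr0.
    apply: cvg_at_right_filter; apply: cvgN; apply: cvgM.
      apply: (@continuous_comp _ _ _ Num.sqrt (fun u => u ^+ k.+1)).
        exact: sqrt_continuous.
      exact: exprn_continuous.
    exact: continuous_expRN.
  - rewrite -oppr0; apply: cvgN.
    have : expR 4^-1 * (Num.sqrt t ^+ k.+1 * expR (- (1 * Num.sqrt t))) @[t --> (+oo : set_system R)] --> expR 4^-1 * 0.
      apply: cvgM; first exact: cvg_cst.
      apply: (cvg_comp Num.sqrt (fun u => u ^+ k.+1 * expR (- (1 * u)))).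
        exact: cvgy_sqrt.
      exact: cvgy_exprn_expRN.
    rewrite mulr0; apply: squeeze_cvgr; last exact: cvg_cst.
    near=> t; have t0 : 0 < t by near: t; exact: nbhs_pinfty_gt.
    rewrite mulr_ge0 ?exprn_ge0 ?expR_ge0 ?sqrtr_ge0//= mulrCA mul1r.
    by rewrite ler_wpM2l ?exprn_ge0 ?sqrtr_ge0// expRN_le_sqrt// ltW.
  - by apply: integrable_half_lineB.
rewrite subr0 RintegralB//= => /eqP; rewrite subr_eq0 => /eqP ->.
by rewrite RintegralZl.
Unshelve. all: end_near. Qed.

(** The recurrence moves [k] by 2, hence an induction on two consecutive values, started at the
    arguments 1/2 and 1. *)
Lemma euler_integral_half_gt0 k : 0 < euler_integral ((k%:R + 1) / 2 : R).
Proof.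
have [] : 0 < euler_integral ((k%:R + 1) / 2 : R) /\ 0 < euler_integral ((k.+1%:R + 1) / 2 : R); last by [].
elim: k => [|k [h0 h1]]; last first.
  split; first exact: h1.
  rewrite (_ : (k.+2%:R + 1) / 2 = (k%:R + 1) / 2 + 1); last by rewrite -addn2 natrD; field.
  rewrite euler_integral_half_rec; apply: mulr_gt0 _ h0.
  by rewrite divr_gt0// ltr_wpDl.
rewrite !euler_integral_half; split.
  (* Since [sqrt t <= 1 + t <= expR t], the integrand at argument 1/2 dominates [expR (- (2 * t))],
     whose integral is 1/2. *)
  apply: (@lt_le_trans _ _ (2^-1)); first by rewrite invr_gt0.
  have := integral_exprn_expRN 0 (ltr0n R 2).
  rewrite fact0 expr1 mul1r => /(congr1 fine)/= <-.
  apply: le_integral_half_line (integrable_exprn_expRN 0 (ltr0n R 2)) (ie 0) _.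
  move=> t t0; rewrite /e !expr0 !mul1r.
    rewrite (_ : - (2 * t) = - t - t); last by ring.
    rewrite expRD ler_wpM2r ?expR_ge0// expRN lef_pV2 ?posrE ?expR_gt0 ?sqrtr_gt0//.
    apply: le_trans (expR_ge1Dx t).
    rewrite -{2}(sqr_sqrtr (ltW t0)).
    by have := sqr_ge0 (Num.sqrt t - 2^-1); lra.
have := integral_exprn_expRN 0 (@ltr01 R).
rewrite fact0 expr1n divr1 => /(congr1 fine)/= i1.
suff -> : \int[mu]_(x in `]0, +oo[) e 1 x = 1 by [].
rewrite -[RHS]i1; apply: eq_integral_half_line => t t0.
by rewrite /e expr1 divff ?gt_eqF ?sqrtr_gt0// expr0 !mul1r.
Qed.

End sqrt_moments.

(** * Moments of K_nu *)

Section cosh_integrals.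
Context {R : realType}.
Notation mu := (@lebesgue_measure R).
Implicit Types (a c d t : R) (k n : nat).

Definition sinh t : R := (expR t - expR (- t)) / 2.

Lemma cosh_gt0 t : 0 < cosh t.
Proof. by rewrite /cosh divr_gt0// addr_gt0// expR_gt0. Qed.

Lemma cosh0 : cosh 0 = 1 :> R.
Proof. by rewrite /cosh oppr0 expR0; field. Qed.

Lemma coshN t : cosh (- t) = cosh t.
Proof. by rewrite /cosh opprK addrC. Qed.

Lemma sinh0 : sinh 0 = 0 :> R.
Proof. by rewrite /sinh oppr0 subrr mul0r. Qed.

#[local] Instance is_derive_cosh t : is_derive t 1 (@cosh R) (sinh t).
Proof. by rewrite /cosh; apply: trigger_derive; rewrite /GRing.scale/= /sinh; field. Qed.

#[local] Instance is_derive_sinh t : is_derive t 1 sinh (cosh t).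
Proof. by rewrite /sinh; apply: trigger_derive; rewrite /GRing.scale/= /cosh; field. Qed.

Lemma continuous_cosh : continuous (@cosh R).
Proof. by move=> t; apply/differentiable_continuous/derivable1_diffP; exact: ex_derive. Qed.

Lemma continuous_sinh : continuous sinh.
Proof. by move=> t; apply/differentiable_continuous/derivable1_diffP; exact: ex_derive. Qed.

Lemma coshD_mul a t : cosh ((a + 1) * t) = cosh (a * t) * cosh t + sinh (a * t) * sinh t.
Proof.
rewrite (_ : (a + 1) * t = a * t + t); last by ring.
by rewrite /cosh /sinh opprD !expRD; field.
Qed.

Lemma normr_sinh_le t : `|sinh t| <= cosh t.
Proof.
rewrite /sinh /cosh; have := expR_ge0 t; have := expR_ge0 (- t).
by rewrite ler_norml => h1 h2; apply/andP; split; lra.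
Qed.

Lemma cosh_le_expR t : cosh t <= expR `|t|.
Proof.
have h1 : expR t <= expR `|t| by rewrite ler_expR ler_norm.
have h2 : expR (- t) <= expR `|t| by rewrite ler_expR -normrN ler_norm.
by rewrite /cosh; lra.
Qed.

Lemma cosh_ge_expR t : expR t / 2 <= cosh t.
Proof. by rewrite /cosh; have := expR_ge0 (- t); lra. Qed.

Lemma continuous_mul_const (f : R -> R) a : continuous f -> continuous (fun t => f (a * t)).
Proof.
move=> cf t; apply: (@continuous_comp _ _ _ ( *%R a) f); last exact: cf.
by apply: cvgM; [exact: cvg_cst|exact: cvg_id].
Qed.

Lemma continuous_quot_cosh (f : R -> R) a k : continuous f ->
  continuous (fun t => f (a * t) / cosh t ^+ k).
Proof.
move=> cf t; apply: cvgM; first exact: continuous_mul_const.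
apply: cvgV; first by rewrite gt_eqF// exprn_gt0// cosh_gt0.
apply: (@continuous_comp _ _ _ (@cosh R) (fun u => u ^+ k)).
  exact: continuous_cosh.
exact: exprn_continuous.
Qed.

(** [cosh (a t)] is at most [expR (|a| t)] and [cosh t] at least [expR t / 2]; the bound decays
    exponentially when [|a| < k]. *)
Lemma cosh_quot_le a k t : 0 <= t ->
  cosh (a * t) / cosh t ^+ k <= 2 ^+ k * expR (- ((k%:R - `|a|) * t)).
Proof.
move=> t0; rewrite ler_pdivrMr ?exprn_gt0 ?cosh_gt0//.
apply: (le_trans (cosh_le_expR _)); rewrite normrM (ger0_norm t0).
have h : (expR t / 2) ^+ k <= cosh t ^+ k.
  by rewrite lerXn2r// ?nnegrE ?divr_ge0 ?expR_ge0 ?(ltW (cosh_gt0 _))// cosh_ge_expR.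
apply: le_trans (ler_wpM2l _ h); last by rewrite mulr_ge0 ?exprn_ge0 ?expR_ge0.
rewrite expr_div_n mulrAC mulrCA divff ?mulr1 ?expf_neq0//.
by rewrite -expRM_natl -expRD ler_expR; lra.
Qed.

Let cosh_quot_ge0 a k t : 0 <= cosh (a * t) / cosh t ^+ k.
Proof. by rewrite divr_ge0 ?exprn_ge0 ?(ltW (cosh_gt0 _)). Qed.

Lemma integrable_cosh_quot a k : `|a| < k%:R ->
  mu.-integrable `]0, +oo[ (EFin \o (fun t => cosh (a * t) / cosh t ^+ k)).
Proof.
move=> ak; have ak0 : 0 < k%:R - `|a| by rewrite subr_gt0.
apply: le_integrable_half_line (integrable_half_lineZ (2 ^+ k) (integrable_exprn_expRN 0 ak0)).
  by apply: measurable_half_line => t _; apply: continuous_quot_cosh; exact: continuous_cosh.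
move=> t t0; rewrite ger0_norm// expr0 mul1r; exact/cosh_quot_le/ltW.
Qed.

(** The parameter [a] is real, not only an order [nu], because the recurrence below is also used at
    [a = -1]. *)
Definition cosh_integral a k : R := \int[mu]_(t in `]0, +oo[) (cosh (a * t) / cosh t ^+ k).

Lemma cvgy_sinh_quot a k : `|a| < k%:R -> sinh (a * t) / cosh t ^+ k @[t --> +oo] --> 0.
Proof.
move=> ak; have ak0 : 0 < k%:R - `|a| by rewrite subr_gt0.
apply: norm_cvg0.
have : 2 ^+ k * (t ^+ 0 * expR (- ((k%:R - `|a|) * t))) @[t --> (+oo : set_system R)] --> 2 ^+ k * (0 : R).
  by apply: cvgM; [exact: cvg_cst|exact: cvgy_exprn_expRN].
rewrite mulr0; apply: squeeze_cvgr; last exact: cvg_cst.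
near=> t; have t0 : 0 < t by near: t; exact: nbhs_pinfty_gt.
rewrite normr_ge0/= expr0 mul1r; apply: le_trans (cosh_quot_le a k (ltW t0)).
rewrite normrM normfV (ger0_norm (exprn_ge0 _ (ltW (cosh_gt0 _)))).
by rewrite ler_wpM2r ?invr_ge0 ?exprn_ge0 ?(ltW (cosh_gt0 _))// normr_sinh_le.
Unshelve. all: end_near. Qed.

(* Integrate the derivative of [sinh (a t) / cosh t ^ (k + 1)]. *)
Lemma cosh_integral_rec a k : `|a| < k.+1%:R ->
  k.+1%:R * cosh_integral (a + 1) k.+2 = (a + k.+1%:R) * cosh_integral a k.+1.
Proof.
move=> ak.
have ak1 : `|a + 1| < k.+2%:R.
  by rewrite (le_lt_trans (ler_normD _ _))// normr1 -natr1 ltrD2r.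
have i1 := integrable_half_lineZ (a + k.+1%:R) (integrable_cosh_quot ak).
have i2 := integrable_half_lineZ k.+1%:R (integrable_cosh_quot ak1).
rewrite /cosh_integral.
have : \int[mu]_(t in `]0, +oo[) ((a + k.+1%:R) * (cosh (a * t) / cosh t ^+ k.+1)
    - k.+1%:R * (cosh ((a + 1) * t) / cosh t ^+ k.+2)) = 0 - 0.
  apply: (@integrable_FTC2_0y R (fun t => (a + k.+1%:R) * (cosh (a * t) / cosh t ^+ k.+1)
    - k.+1%:R * (cosh ((a + 1) * t) / cosh t ^+ k.+2)) (fun t => sinh (a * t) / cosh t ^+ k.+1)).
  - move=> t _; apply: cvgB; (apply: cvgM; first exact: cvg_cst);
      apply: continuous_quot_cosh; exact: continuous_cosh.
  - move=> t _.
    have ct : cosh t != 0 by rewrite gt_eqF// cosh_gt0.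
    have ht : is_derive (a * t) 1 sinh _ := is_derive_sinh (a * t).
    have dat : is_derive t 1 ( *%R a) a.
      by apply: trigger_derive; rewrite /GRing.scale/=; ring.
    have d1 : is_derive t 1 (fun t => sinh (a * t)) (a * cosh (a * t)).
      by apply: (trigger_derive (is_derive1_comp ht dat)); rewrite mulrC.
    have d2 : is_derive t 1 (fun t => (cosh t ^+ k.+1)^-1) (- (k.+1%:R * sinh t / cosh t ^+ k.+2)).
      have d3 : is_derive t 1 (fun t => cosh t ^+ k.+1) _ := is_derive_exprn k.+1 (is_derive_cosh t).
      have ck : cosh t ^+ k.+1 != 0 by rewrite expf_neq0.
      have dV := @is_deriveV R (fun t => cosh t ^+ k.+1) t _ 1 ck d3.
      apply: (trigger_derive dV).
      rewrite /GRing.scale/= !exprS; field.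
      by rewrite ct expf_neq0.
    apply: trigger_derive; rewrite /GRing.scale/= coshD_mul !exprS.
    by field; rewrite ct expf_neq0.
  - rewrite -[X in _ --> X](_ : sinh (a * 0) / cosh 0 ^+ k.+1 = 0); last first.
      by rewrite mulr0 sinh0 mul0r.
    by apply: cvg_at_right_filter; apply: continuous_quot_cosh; exact: continuous_sinh.
  - exact: cvgy_sinh_quot.
  - exact: integrable_half_lineB.
rewrite subr0 RintegralB//= => /eqP; rewrite subr_eq0 => /eqP.
by rewrite !RintegralZl//; exact: integrable_cosh_quot.
Qed.

(** The antiderivative of [1 / cosh t] is [2 atan (expR t)], which runs from [pi / 2] to [pi]. *)
Lemma cosh_integral01 : cosh_integral 0 1 = pi / 2.
Proof.
rewrite /cosh_integral.
rewrite (_ : pi / 2 = 2 * (pi / 2) - 2 * atan (expR 0)); last by rewrite expR0 atan1; field.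
have := @integrable_FTC2_0y R (fun t => cosh (0 * t) / cosh t ^+ 1) (fun t => 2 * atan (expR t)) .
apply.
- by move=> t _; apply: continuous_quot_cosh; exact: continuous_cosh.
- move=> t _; apply: trigger_derive; rewrite /GRing.scale/= mul0r cosh0 expr1 /cosh expRN.
  have e0 : expR t != 0 by rewrite gt_eqF// expR_gt0.
  field; rewrite e0 /=.
  by rewrite gt_eqF// addr_gt0// mulr_gt0// expR_gt0.
- apply: cvg_at_right_filter; apply: cvgM; first exact: cvg_cst.
  apply: (@continuous_comp _ _ _ expR atan); first exact: continuous_expR.
  exact: continuous_atan.
- apply: cvgM; first exact: cvg_cst.
  apply: (cvg_comp expR atan); last exact: cvgy_atan.
  apply/cvgryPge => A; near=> t; apply: le_trans (expR_ge1Dx t).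
  by rewrite ler_wpDl//; near: t; exact: nbhs_pinfty_ge.
- by apply: integrable_cosh_quot; rewrite normr0.
Unshelve. all: end_near. Qed.

End cosh_integrals.

(** * Moments of [K_nu] by exchange of integrals *)

Section bessel_moments.
Context {R : realType}.
Notation mu := (@lebesgue_measure R).
Implicit Types (x t : R) (k n nu : nat).

Lemma tonelli_half_line (h : R -> R -> R) :
  measurable_fun ((`]0, +oo[ : set R) `*` (`]0, +oo[ : set R)) (fun z => h z.1 z.2) ->
  (forall x y : R, 0 < x -> 0 < y -> 0 <= h x y) ->
  (\int[mu]_(x in `]0%R, +oo[) \int[mu]_(y in `]0%R, +oo[) (h x y)%:E =
   \int[mu]_(y in `]0%R, +oo[) \int[mu]_(x in `]0%R, +oo[) (h x y)%:E)%E.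
Proof.
move=> mh h0; pose D : set (measurableTypeR R) := `]0%R, +oo[%classic.
have mD : measurable D by exact: measurable_itv.
pose f := (fun z : measurableTypeR R * measurableTypeR R => (h z.1 z.2)%:E) \_ (D `*` D).
have mf : measurable_fun setT f.
  by apply/(measurable_restrictT _ (measurableX mD mD)); exact/measurable_EFinP.
have f0 z : (0 <= f z)%E.
  rewrite /f patchE; case: ifPn => //; rewrite inE => -[/=].
  by rewrite /D/= !in_itv/= !andbT lee_fin; exact: h0.
have := @fubini_tonelli _ _ _ _ R mu mu f mf f0.
have -> : (\int[mu]_x \int[mu]_y f (x, y) =
    \int[mu]_(x in D) \int[mu]_(y in D) (h x y)%:E)%E.
  rewrite [RHS]integral_mkcond; apply: eq_integral => x _; rewrite patchE.
  case: ifPn => xD.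
    rewrite [RHS]integral_mkcond; apply: eq_integral => y _.
    by rewrite /f !patchE in_setX/= xD.
  apply: integral0_eq => y _; rewrite /f patchE in_setX/= (negbTE xD).
  by [].
have -> : (\int[mu]_y \int[mu]_x f (x, y) =
    \int[mu]_(y in D) \int[mu]_(x in D) (h x y)%:E)%E.
  rewrite [RHS]integral_mkcond; apply: eq_integral => y _; rewrite patchE.
  case: ifPn => yD.
    rewrite [RHS]integral_mkcond; apply: eq_integral => x _.
    by rewrite /f !patchE in_setX/= yD andbT.
  apply: integral0_eq => x _; rewrite /f patchE in_setX/= (negbTE yD) andbF.
  by [].
by [].
Qed.

(** The bound [y^m <= m! expR y] with [m = nu + 1] and [y = x cosh t] compares the integrand to
    [cosh (nu t) / cosh t ^+ (nu + 1)]. *)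
Lemma besselK_integrable nu x : 0 < x -> mu.-integrable `]0, +oo[
  (EFin \o (fun t => expR (- (x * cosh t)) * cosh (nu%:R * t))).
Proof.
move=> x0; have nu1 : `|nu%:R| < nu.+1%:R :> R by rewrite ger0_norm// ltr_nat.
apply: le_integrable_half_line (integrable_half_lineZ (nu.+1`!%:R / x ^+ nu.+1) (integrable_cosh_quot nu1)).
  apply: measurable_half_line => t _; apply: cvgM; last first.
    exact: (continuous_mul_const (@continuous_cosh R)).
  apply: (@continuous_comp _ _ _ (fun t => - (x * cosh t)) expR).
    by apply: cvgN; apply: cvgM; [exact: cvg_cst|exact: continuous_cosh].
  exact: continuous_expR.
move=> t _; rewrite ger0_norm ?mulr_ge0 ?expR_ge0 ?(ltW (cosh_gt0 _))//.
rewrite mulrA mulrAC ler_wpM2r ?(ltW (cosh_gt0 _))// -mulrA -invfM -exprMn.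
have y0 : 0 < x * cosh t by rewrite mulr_gt0// cosh_gt0.
rewrite expRN ler_pdivlMr ?exprn_gt0// mulrC ler_pdivrMr ?expR_gt0//.
exact/ler_exprn_expR/ltW.
Qed.

Lemma besselKE nu x : 0 < x -> ((besselK nu x)%:E =
  \int[mu]_(t in `]0%R, +oo[) (expR (- (x * cosh t)) * cosh (nu%:R * t))%:E)%E.
Proof.
move=> x0; rewrite /besselK /Rintegral fineK//.
by apply: integrable_fin_num (besselK_integrable nu x0); exact: measurable_itv.
Qed.

Lemma besselK_ge0 nu x : 0 <= besselK nu x.
Proof. by apply: Rintegral_ge0 => t _; rewrite mulr_ge0 ?expR_ge0 ?(ltW (cosh_gt0 _)). Qed.

(** At fixed [t], the factors before the last [cosh] form the integrand of [integral_sqrt_expRN]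
    with [c = cosh t]. *)
Let h nu k x t : R :=
  Num.sqrt x ^+ k / Num.sqrt x * (expR (- (cosh t * Num.sqrt x)) / 2) * cosh (nu%:R * t).

Let h_ge0 nu k x t : 0 <= h nu k x t.
Proof.
by rewrite !mulr_ge0 ?invr_ge0 ?exprn_ge0 ?sqrtr_ge0 ?expR_ge0 ?(ltW (cosh_gt0 _)).
Qed.

Let measurable_h nu k :
  measurable_fun ((`]0, +oo[ : set R) `*` (`]0, +oo[ : set R)) (fun z => h nu k z.1 z.2).
Proof.
have mD : measurable (`]0, +oo[ : set (measurableTypeR R)) by exact: measurable_itv.
have mc : measurable_fun setT (@cosh R) by apply: continuous_measurable_fun; exact: continuous_cosh.
have ms : measurable_fun setT (@Num.sqrt R) by apply: continuous_measurable_fun; exact: sqrt_continuous.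
have m1 : measurable_fun ((`]0, +oo[ : set R) `*` (`]0, +oo[ : set R)) (fst : R * R -> R).
  exact: measurable_funTS.
have m2 : measurable_fun ((`]0, +oo[ : set R) `*` (`]0, +oo[ : set R)) (snd : R * R -> R).
  exact: measurable_funTS.
apply: measurable_funM; last first.
  apply: (@measurableT_comp _ _ _ _ _ _ (fun t => cosh (nu%:R * t)) _ snd) => //.
  apply: continuous_measurable_fun.
  exact: (continuous_mul_const (@continuous_cosh R)).
apply: measurable_funM.
  have m3 : measurable_fun (`]0, +oo[ : set R) (fun x => Num.sqrt x ^+ k / Num.sqrt x).
    apply: measurable_half_line => x x0.
    have -> : (fun x : R => Num.sqrt x ^+ k / Num.sqrt x) =
        (fun x => Num.sqrt x ^+ k / Num.sqrt x * 1) by apply/funext => y; rewrite mulr1.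
    by apply: (@continuous_at_sqrt_quot _ k (fun=> 1) _ x0) => ?; exact: cvg_cst.
  apply: (measurable_comp mD _ m3 m1).
  by move=> _ [[x y] [/= hx _] <-].
apply: measurable_funM => //; apply: measurableT_comp => //; apply: measurableT_comp => //.
by apply: measurable_funM; apply: measurableT_comp.
Qed.

(** Expand [K_nu] and exchange the integrals: the one in [x] is [k! / cosh t ^+ (k + 1)], and
    [nu <= k] makes the remaining one in [t] converge. *)
Lemma integral_besselK nu k : (nu <= k)%N ->
  (\int[mu]_(x in `]0%R, +oo[) (besselK nu (Num.sqrt x) / 2 * (Num.sqrt x ^+ k / Num.sqrt x))%:E
   = (k`!%:R * cosh_integral nu%:R k.+1)%:E)%E.
Proof.
move=> nuk.
transitivity (\int[mu]_(x in `]0%R, +oo[) \int[mu]_(t in `]0%R, +oo[) (h nu k x t)%:E)%E.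
  apply: eq_integral => x; rewrite inE/= in_itv/= andbT => x0.
  have s0 : 0 < Num.sqrt x by rewrite sqrtr_gt0.
  rewrite -mulrA mulrC EFinM besselKE// -ge0_integralZl_EFin//=; last 2 first.
  - by move=> t _; rewrite lee_fin mulr_ge0 ?expR_ge0 ?(ltW (cosh_gt0 _)).
  - by have := besselK_integrable nu s0; exact: measurable_int.
  by apply: eq_integral => t _; rewrite -EFinM /h (mulrC (cosh t)); congr (_%:E); ring.
rewrite tonelli_half_line//.
have nuk1 : `|nu%:R| < k.+1%:R :> R by rewrite ger0_norm// ltr_nat.
have ic := integrable_cosh_quot nuk1.
rewrite EFinM /cosh_integral /Rintegral fineK; last first.
  by apply: integrable_fin_num ic; exact: measurable_itv.
rewrite -ge0_integralZl_EFin//=; last 2 first.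
- by move=> t _; rewrite lee_fin divr_ge0 ?exprn_ge0 ?(ltW (cosh_gt0 _)).
- exact: measurable_int ic.
apply: eq_integral => t _; rewrite -EFinM.
transitivity ((cosh (nu%:R * t))%:E * (k`!%:R / cosh t ^+ k.+1)%:E)%E; last first.
  by rewrite -EFinM; congr (_%:E); ring.
rewrite -(integral_sqrt_expRN k (cosh_gt0 t)) -ge0_integralZl_EFin//=.
- by apply: eq_integral => x _; rewrite -EFinM mulrC.
- by have := integrable_sqrt_expRN k (cosh_gt0 t); exact: measurable_int.
- exact/ltW/cosh_gt0.
Qed.

End bessel_moments.

(** * Power sums over the Gauss nodes *)

Section gauss_moments.
Context {R : realType}.
Notation mu := (@lebesgue_measure R).

(** For a nonnegative integrand the Abel limit is the ordinary integral: along [s = 1 / (n + 1)] the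
    damping factor increases to 1, so monotone convergence applies. *)
Lemma is_abel_integral_ge0 (f : R -> R) (l : R) : (forall t, 0 < t -> 0 <= f t) ->
  is_abel_integral f l -> (\int[mu]_(t in `]0%R, +oo[) (f t)%:E = l%:E)%E.
Proof.
move=> f0 [fint fl].
have mD : measurable (`]0%R, +oo[ : set (measurableTypeR R)) by exact: measurable_itv.
pose g (n : nat) t : \bar R := (f t * expR (- (n.+1%:R^-1 * t)))%:E.
have gint n : mu.-integrable `]0, +oo[ (g n) by apply: fint; rewrite invr_gt0.
have Dgt0 (t : R) : `]0%R, +oo[%classic t -> 0 < t by rewrite /= in_itv/= andbT.
have g0 n t : `]0%R, +oo[%classic t -> (0 <= g n t)%E.
  by move=> /Dgt0 t0; rewrite lee_fin mulr_ge0 ?expR_ge0// f0.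
have ndg t : `]0%R, +oo[%classic t -> nondecreasing_seq (g ^~ t).
  move=> /Dgt0 t0 m n mn; rewrite lee_fin ler_wpM2l ?f0// ler_expR lerN2.
  by apply: ler_wpM2r; [exact: ltW|rewrite lef_pV2 ?posrE// ler_nat].
have := @cvg_monotone_convergence _ _ R mu _ mD g (fun n => measurable_int _ (gint n)) g0 ndg.
have -> : (\int[mu]_(x in `]0%R, +oo[) (limn (g ^~ x)) = \int[mu]_(t in `]0%R, +oo[) (f t)%:E)%E.
  apply: eq_integral => t _; apply/cvg_lim => //.
  rewrite -[f t]mulr1 -expR0 -oppr0 -(mul0r t).
  apply: cvg_EFin; first exact: nearW.
  apply: cvgM; first exact: cvg_cst.
  apply: (cvg_comp _ expR); last exact: continuous_expR.
  by apply: cvgN; apply: cvgM; [exact: cvg_harmonic|exact: cvg_cst].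
have : \int[mu]_(t in `]0%R, +oo[) (f t * expR (- (n.+1%:R^-1 * t))) @[n --> \oo] --> l.
  move/cvg_at_rightP : fl; apply; split; first by move=> n; rewrite invr_gt0.
  exact: cvg_harmonic.
have gE n : (\int[mu]_(t in `]0%R, +oo[) g n t =
    (\int[mu]_(t in `]0%R, +oo[) (f t * expR (- (n.+1%:R^-1 * t))))%:E)%E.
  by rewrite /Rintegral fineK//; exact: integrable_fin_num (gint n).
move=> fl'; under eq_fun do rewrite gE.
have flE : (\int[mu]_(t in `]0%R, +oo[) (f t * expR (- (n.+1%:R^-1 * t))))%:E @[n --> \oo] --> l%:E.
  by apply: cvg_EFin; [exact: nearW|exact: fl'].
by move=> /cvg_unique; apply => //; exact: flE.
Qed.

(** [kappa] merges the two parity cases into the single power [t^((kappa - 1) / 2)]. *)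
Lemma gauss_weightE mu' nu (t : R) : 0 < t -> gauss_weight mu' nu t =
  besselK nu (Num.sqrt t) / 2 * (Num.sqrt t ^+ kappa mu' nu / Num.sqrt t).
Proof.
move=> t0; rewrite /gauss_weight /kappa; congr (_ * _); rewrite -powR_half//.
by case: ifP => // _; congr (_ `^ _); rewrite -[in RHS]natr1 addrK.
Qed.

(** Exactness on ['X^l], where [l <= 2n - 1]: as [t^l] is the power [2l] of [sqrt t], the integral
    is the moment of [K_nu] of index [kappa + 2l]. *)
Lemma gauss_rule_moment mu' nu n (x w : 'I_n -> R) l :
  is_gauss_rule (gauss_weight mu' nu) x w -> (nu <= mu')%N -> (l < 2 * n)%N ->
  \sum_(j < n) w j * x j ^+ l =
  (kappa mu' nu + 2 * l)`!%:R * cosh_integral nu%:R (kappa mu' nu + 2 * l).+1.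
Proof.
move=> [_ _ _ gq] numu ln.
have /gq : (size ('X^l : {poly R}) <= (2 * n - 1).+1)%N.
  by rewrite size_polyXn; lia.
under eq_bigr do rewrite hornerXn.
move/is_abel_integral_ge0 => h; apply: EFin_inj; rewrite -h; last first.
  move=> t t0; rewrite hornerXn gauss_weightE// mulr_ge0 ?exprn_ge0 ?(ltW t0)//.
  by rewrite !mulr_ge0 ?invr_ge0 ?besselK_ge0 ?exprn_ge0 ?sqrtr_ge0.
rewrite -integral_besselK; last by rewrite /kappa; case: ifP => _; lia.
apply: eq_integral => t; rewrite inE/= in_itv/= andbT => t0.
rewrite hornerXn gauss_weightE// -mulrA; congr ((_ * _)%:E).
by rewrite -[X in _ * X ^+ l](sqr_sqrtr (ltW t0)) -exprM exprD mulrAC.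
Qed.

End gauss_moments.

(** * Bessel functions of the first kind *)

Section bessel_series.
Context {R : realType}.
Implicit Types (x y : R) (nu m n : nat).

Definition bessel_coeff nu m : R := (-1) ^+ m / (m`! * (m + nu)`!)%:R.

(** The Bessel-Clifford function at [- y]. It is a plain power series, so it can be differentiated
    termwise; [J_nu(x)] is [(x/2)^nu] times its value at [(x/2)^2]. *)
Definition bessel_clifford nu y : R := limn (pseries (bessel_coeff nu) y).

Lemma is_cvg_bessel_coeff nu y : cvgn (pseries (bessel_coeff nu) y).
Proof.
apply: normed_cvg; rewrite /normed_series_of /=.
apply: (@series_le_cvg _ _ (exp_coeff `|y|)) => [m|m|m|].
- exact: normr_ge0.
- by rewrite exp_coeff_ge0.
- rewrite /exp_coeff/= /bessel_coeff !normrM normrX normrN1 expr1n mul1r normrX.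
  rewrite mulrC ler_wpM2l ?exprn_ge0//.
  rewrite ger0_norm ?invr_ge0// lef_pV2 ?posrE ?ltr0n ?muln_gt0 ?fact_gt0//.
  by rewrite ler_nat leq_pmulr// fact_gt0.
- exact: is_cvg_series_exp_coeff.
Qed.

Lemma pseries_diffs_bessel_coeff nu :
  pseries_diffs (bessel_coeff nu) = - bessel_coeff nu.+1.
Proof.
apply/funext => m; rewrite /pseries_diffs.
transitivity (- bessel_coeff nu.+1 m); last by [].
rewrite /bessel_coeff exprS addSnnS factS -mulnA natrM.
rewrite [LHS]mulrA [m.+1%:R * _]mulrC -mulrA invfM (mulrA m.+1%:R) divff ?pnatr_eq0//.
by rewrite mul1r mulN1r mulNr.
Qed.

Lemma is_cvg_bessel_coeffN nu y : cvgn (pseries (- bessel_coeff nu) y).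
Proof.
rewrite /pseries (_ : (fun _ => _) = - (fun i => bessel_coeff nu i * y ^+ i)); last first.
  by apply/funext => i; rewrite /= [RHS]/(- _) /= mulNr.
by rewrite is_cvg_seriesN; exact: is_cvg_bessel_coeff.
Qed.

(** Formal differentiation raises the order and changes the sign. It is justified by convergence, at
    the point [|y| + 1] beyond [y], of the series and its first two formal derivatives. *)
Lemma is_derive_bessel_clifford nu y :
  is_derive y 1 (bessel_clifford nu) (- bessel_clifford nu.+1 y).
Proof.
have -> : - bessel_clifford nu.+1 y = limn (pseries (pseries_diffs (bessel_coeff nu)) y).
  rewrite pseries_diffs_bessel_coeff /bessel_clifford.
  rewrite /pseries (_ : (fun i => (- _) i * _) = - (fun i => bessel_coeff nu.+1 i * y ^+ i)); last first.
    by apply/funext => i; rewrite /= [RHS]/(- _) /= mulNr.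
  by rewrite lim_seriesN//; exact: is_cvg_bessel_coeff.
apply: (@pseries_snd_diffs _ _ (`|y| + 1)).
- exact: is_cvg_bessel_coeff.
- by rewrite pseries_diffs_bessel_coeff; exact: is_cvg_bessel_coeffN.
- rewrite pseries_diffs_bessel_coeff pseries_diffsN pseries_diffs_bessel_coeff opprK.
  exact: is_cvg_bessel_coeff.
- by rewrite [ltRHS]ger0_norm ?addr_ge0// ltrDl.
Qed.

Lemma bessel_coeff0_rec nu : nu.+1%:R * bessel_coeff nu.+1 0 = bessel_coeff nu 0.
Proof.
rewrite /bessel_coeff expr0 fact0 !mul1n !add0n factS natrM.
by rewrite !mul1r invfM mulrA divff ?mul1r// pnatr_eq0.
Qed.

Lemma bessel_coeffS_rec nu m :
  nu.+1%:R * bessel_coeff nu.+1 m.+1 - bessel_coeff nu m.+1 = bessel_coeff nu.+2 m.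
Proof.
rewrite /bessel_coeff !addSn !addnS !factS !natrM exprS -!natr1 !natrD.
have h1 : m`!%:R != 0 :> R by rewrite pnatr_eq0 -lt0n fact_gt0.
have h2 : (m + nu)`!%:R != 0 :> R by rewrite pnatr_eq0 -lt0n fact_gt0.
by field; rewrite h1 h2 /= -?natrD !natr1 ?pnatr_eq0.
Qed.

(** On the right the constant terms cancel, so its partial sums of [n + 1] terms equal [y] times
    those of [n] terms on the left; then pass to the limit. *)
Lemma bessel_clifford_rec nu y : y * bessel_clifford nu.+2 y =
  nu.+1%:R * bessel_clifford nu.+1 y - bessel_clifford nu y.
Proof.
have h n : nu.+1%:R * pseries (bessel_coeff nu.+1) y n.+1 - pseries (bessel_coeff nu) y n.+1
    = y * pseries (bessel_coeff nu.+2) y n.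
  rewrite /pseries /series/= !big_nat_recl//= mulrDr mulr_sumr mulr_sumr opprD addrACA.
  rewrite -sumrB !expr0 !mulr1.
  rewrite bessel_coeff0_rec subrr add0r; apply: eq_bigr => m _.
  by rewrite (mulrA nu.+1%:R) -mulrBl bessel_coeffS_rec exprS mulrCA.
have c1 : cvgn (pseries (bessel_coeff nu.+1) y) by exact: is_cvg_bessel_coeff.
have c0 : cvgn (pseries (bessel_coeff nu) y) by exact: is_cvg_bessel_coeff.
have c2 : cvgn (pseries (bessel_coeff nu.+2) y) by exact: is_cvg_bessel_coeff.
have l2 : y * pseries (bessel_coeff nu.+2) y n @[n --> \oo] --> y * bessel_clifford nu.+2 y.
  by apply: cvgM; [exact: cvg_cst|exact: c2].
have l1 : nu.+1%:R * pseries (bessel_coeff nu.+1) y n - pseries (bessel_coeff nu) y n @[n --> \oo]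
    --> nu.+1%:R * bessel_clifford nu.+1 y - bessel_clifford nu y.
  by apply: cvgB; [apply: cvgM; [exact: cvg_cst|exact: c1]|exact: c0].
have l3 : y * pseries (bessel_coeff nu.+2) y n @[n --> \oo]
    --> nu.+1%:R * bessel_clifford nu.+1 y - bessel_clifford nu y.
  by move: l1; rewrite -cvg_shiftS; under eq_fun do rewrite h.
exact: cvg_unique l2 l3.
Qed.

Lemma bessel_clifford00 : bessel_clifford 0 0 = 1.
Proof.
apply/cvg_lim => //; apply: cvg_near_cst; exists 1%N => // -[//|n] _.
rewrite /pseries /series/= big_nat_recl// big1 ?addr0 => [|i _]; last by rewrite expr0n mulr0.
by rewrite /bessel_coeff !expr0 fact0 mulr1 divr1.
Qed.

Lemma besselJE nu x : besselJ nu x = (x / 2) ^+ nu * bessel_clifford nu ((x / 2) ^+ 2).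
Proof.
apply/cvg_lim => //.
rewrite (_ : series _ = (fun n => (x / 2) ^+ nu * pseries (bessel_coeff nu) ((x / 2) ^+ 2) n)).
  by apply: cvgM; [exact: cvg_cst|exact: is_cvg_bessel_coeff].
apply/funext => n; rewrite /pseries /series/= mulr_sumr; apply: eq_bigr => m _.
by rewrite exprD exprM /bessel_coeff; ring.
Qed.

End bessel_series.

(** * Recurrences, derivatives and boundedness of [J_nu] *)

Section bessel_functions.
Context {R : realType}.
Implicit Types (x y : R) (nu m n : nat).

Lemma besselJ_rec nu x : x * (besselJ nu x + besselJ nu.+2 x) = 2 * nu.+1%:R * besselJ nu.+1 x.
Proof.
have := bessel_clifford_rec nu ((x / 2) ^+ 2) => h.
rewrite !besselJE; move: h.
move: (bessel_clifford nu _) (bessel_clifford nu.+1 _) (bessel_clifford nu.+2 _) => a b c h.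
(* Solving for the lowest order avoids a division by [x], which may be 0. *)
have -> : a = nu.+1%:R * b - (x / 2) ^+ 2 * c by rewrite h; ring.
by rewrite !exprS; field.
Qed.

(** The form of [J_nu'] without division by [x], valid at 0 too. *)
Definition dbesselJ nu x : R :=
  if nu is n.+1 then (besselJ n x - besselJ n.+2 x) / 2 else - besselJ 1 x.

Lemma is_derive_besselJ nu x : is_derive x 1 (@besselJ R nu) (dbesselJ nu x).
Proof.
rewrite (_ : besselJ nu = fun x => (x / 2) ^+ nu * bessel_clifford nu ((x / 2) ^+ 2)); last first.
  by apply/funext => z; exact: besselJE.
have dc : is_derive ((x / 2) ^+ 2) 1 (bessel_clifford nu) _ :=
  is_derive_bessel_clifford nu ((x / 2) ^+ 2).
have dx : is_derive x 1 (fun x : R => (x / 2) ^+ 2) (x / 2).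
  by apply: trigger_derive; rewrite /GRing.scale/=; field.
have dcx := @is_derive1_comp R (bessel_clifford nu) (fun x => (x / 2) ^+ 2) x _ _ dc dx.
have dn : is_derive x 1 (fun x : R => (x / 2) ^+ nu) (nu%:R * (x / 2) ^+ nu.-1 / 2).
  by apply: trigger_derive; rewrite /GRing.scale/=; field.
apply: (trigger_derive (is_deriveM dn dcx)); rewrite /GRing.scale/=.
case: nu {dc dcx dn} => [|nu] /=; first by rewrite !besselJE !expr0 expr1; field.
have h := bessel_clifford_rec nu ((x / 2) ^+ 2).
rewrite !besselJE; move: h.
move: (bessel_clifford nu _) (bessel_clifford nu.+1 _) (bessel_clifford nu.+2 _) => a b c h.
have -> : a = nu.+1%:R * b - (x / 2) ^+ 2 * c by rewrite h; ring.
by rewrite !exprS; field.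
Qed.

Lemma continuous_besselJ nu : continuous (@besselJ R nu).
Proof.
by move=> x; apply/differentiable_continuous/derivable1_diffP; have [] := is_derive_besselJ nu x.
Qed.

Lemma dbesselJ_up nu x : x * dbesselJ nu x = nu%:R * besselJ nu x - x * besselJ nu.+1 x.
Proof.
case: nu => [|nu] /=; first by ring.
rewrite (_ : nu.+1%:R * _ = x * (besselJ nu x + besselJ nu.+2 x) / 2); first by field.
by rewrite besselJ_rec; field.
Qed.

Lemma dbesselJ_down nu x :
  x * dbesselJ nu.+1 x = x * besselJ nu x - nu.+1%:R * besselJ nu.+1 x.
Proof.
rewrite (_ : nu.+1%:R * _ = x * (besselJ nu x + besselJ nu.+2 x) / 2); first by rewrite /=; field.
by rewrite besselJ_rec; field.
Qed.

Lemma besselJ00 : besselJ 0 0 = 1 :> R.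
Proof. by rewrite besselJE mul0r expr0 expr0n/= mul1r bessel_clifford00. Qed.

Lemma besselJS0 nu : besselJ nu.+1 0 = 0 :> R.
Proof. by rewrite besselJE mul0r expr0n/= mul0r. Qed.

(* The derivative of [J_0^2 + J_1^2] is [- 2 J_1^2 / x]. *)
Lemma besselJ01_bounded x : 0 <= x -> besselJ 0 x ^+ 2 + besselJ 1 x ^+ 2 <= 1.
Proof.
rewrite le_eqVlt => /predU1P[<-|x0]; first by rewrite besselJ00 besselJS0; lra.
pose E x : R := besselJ 0 x ^+ 2 + besselJ 1 x ^+ 2.
pose dE x : R := - besselJ 1 x * (besselJ 0 x + besselJ 2 x).
have dEE (z : R) : is_derive z 1 E (dE z).
  have d0 := is_derive_besselJ 0 z; have d1 := is_derive_besselJ 1 z.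
  by rewrite /E; apply: trigger_derive; rewrite /GRing.scale/= /dE; field.
have [|c] := @MVT _ E dE 0 x x0.
  apply: continuous_subspaceT => z; apply/differentiable_continuous/derivable1_diffP.
  by have [] := dEE z.
rewrite in_itv/= => /andP[c0 _] h.
have : E x <= E 0.
  rewrite -subr_le0 h subr0 pmulr_lle0// /dE.
  rewrite (_ : besselJ 0 c + besselJ 2 c = 2 * besselJ 1 c / c); last first.
    have := besselJ_rec 0 c; rewrite mulr1 => <-.
    by rewrite mulrAC divff ?mul1r// gt_eqF.
  rewrite (_ : _ * _ = - (2 * besselJ 1 c ^+ 2 / c)); last by ring.
  by rewrite oppr_le0; apply: divr_ge0; [rewrite mulr_ge0// sqr_ge0|exact: ltW].
by rewrite {2}/E besselJ00 besselJS0 expr1n expr0n/= addr0.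
Qed.

(** Orders 0 and 1 are bounded by 1. The next orders follow from the three-term recurrence for
    [x > 1], where its factor [1 / x] is harmless, and from continuity on [[0, 1]]. *)
Lemma besselJ_bounded nu : exists2 C : R, 0 <= C & forall x, 0 <= x -> `|besselJ nu x| <= C.
Proof.
have [] : (exists2 C : R, 0 <= C & forall x, 0 <= x -> `|besselJ nu x| <= C) /\
  (exists2 C : R, 0 <= C & forall x, 0 <= x -> `|besselJ nu.+1 x| <= C); last by [].
elim: nu => [|nu [[C0 C00 h0] [C1 C10 h1]]].
  split; exists 1 => // x x0; rewrite -sqrtr_sqr -sqrtr1 ler_wsqrtr//;
    by apply: le_trans (besselJ01_bounded x0); rewrite (lerDl, lerDr) sqr_ge0.
split; first by exists C1.
have [||c _ hc] := @EVT_max R (fun x => `|besselJ nu.+2 x|) 0 1 => //.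
  apply: continuous_subspaceT => z; apply: cvg_norm; exact: continuous_besselJ.
exists (`|besselJ nu.+2 c| + (2 * nu.+1%:R * C1 + C0)).
  by rewrite !addr_ge0// !mulr_ge0.
move=> x x0; have [x1|x1] := leP x 1.
  rewrite (le_trans (hc _ _)) ?in_itv/= ?x0//.
  by rewrite lerDl addr_ge0// !mulr_ge0.
rewrite (_ : besselJ nu.+2 x = 2 * nu.+1%:R * besselJ nu.+1 x / x - besselJ nu x); last first.
  by have := besselJ_rec nu x => <-; field; rewrite gt_eqF// (lt_trans ltr01).
apply: (le_trans (ler_normB _ _)); rewrite ler_wpDl// lerD ?h0//.
rewrite normrM normfV (ger0_norm x0) ler_pdivrMr ?(lt_trans ltr01)//.
rewrite normrM (ger0_norm (_ : 0 <= 2 * nu.+1%:R)) ?mulr_ge0//.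
rewrite -[leRHS]mulrA ler_wpM2l ?mulr_ge0//.
by rewrite (le_trans (h1 _ x0))// ler_peMr// ltW.
Qed.

End bessel_functions.

(** * Abel integrals of x^k J_nu(omega x) *)

Section bessel_laplace.
Context {R : realType}.
Notation mu := (@lebesgue_measure R).
Implicit Types (s t x : R) (nu k : nat).

Variable omega : R.
Hypothesis omega0 : 0 < omega.

Definition bessel_kernel k nu s x : R := x ^+ k * besselJ nu (omega * x) * expR (- (s * x)).

Definition bessel_laplace k nu s : R := \int[mu]_(x in `]0, +oo[) bessel_kernel k nu s x.

Notation f := bessel_kernel.
Notation A := bessel_laplace.

Let scale_derive nu x : is_derive x 1 (fun x => besselJ nu (omega * x)) (omega * dbesselJ nu (omega * x)).
Proof.
have dl : is_derive x 1 ( *%R omega) omega.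
  by apply: trigger_derive; rewrite /GRing.scale/=; ring.
apply: (trigger_derive (@is_derive1_comp R (besselJ nu) ( *%R omega) x _ _ (is_derive_besselJ nu (omega * x)) dl)).
by rewrite mulrC.
Qed.

Lemma is_derive_bessel_kernel k nu s x : is_derive x 1 (f k nu s)
  ((k%:R * x ^+ k.-1 * besselJ nu (omega * x) + x ^+ k * (omega * dbesselJ nu (omega * x))
    - s * x ^+ k * besselJ nu (omega * x)) * expR (- (s * x))).
Proof.
have d1 : is_derive x 1 (fun x : R => x ^+ k) (k%:R * x ^+ k.-1).
  by apply: trigger_derive; rewrite /GRing.scale/= mulr1.
have d2 : is_derive x 1 (fun x : R => expR (- (s * x))) (- s * expR (- (s * x))).
  by apply: trigger_derive; rewrite /GRing.scale/=; ring.
apply: (trigger_derive (is_deriveM (is_deriveM d1 (scale_derive nu x)) d2)).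
rewrite [X in X *: _ + _](_ : _ = x ^+ k * besselJ nu (omega * x))//.
by rewrite /GRing.scale/=; ring.
Qed.

Lemma continuous_bessel_kernel k nu s : continuous (f k nu s).
Proof.
move=> x; apply/differentiable_continuous/derivable1_diffP.
by have [] := is_derive_bessel_kernel k nu s x.
Qed.

(** The constant is uniform in [k] and [s], so that it also yields a dominating function when [s]
    varies. *)
Lemma bessel_kernel_bound nu : exists2 C : R, 0 <= C &
  forall k s x, 0 < x -> `|f k nu s x| <= C * (x ^+ k * expR (- (s * x))).
Proof.
have [C C0 hC] := @besselJ_bounded R nu; exists C => // k s x x0.
rewrite /f mulrAC normrM (ger0_norm (_ : 0 <= _ * expR _)); last first.
  by rewrite mulr_ge0 ?expR_ge0// exprn_ge0// ltW.
rewrite mulrC ler_wpM2r ?mulr_ge0 ?expR_ge0 ?exprn_ge0 ?(ltW x0)//.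
by apply: hC; rewrite mulr_ge0 ?ltW.
Qed.

Lemma integrable_bessel_kernel k nu s : 0 < s ->
  mu.-integrable `]0, +oo[ (EFin \o f k nu s).
Proof.
move=> s0; have [C C0 hC] := bessel_kernel_bound nu.
apply: le_integrable_half_line (integrable_half_lineZ C (integrable_exprn_expRN k s0)).
  by apply: measurable_half_line => x _; exact: continuous_bessel_kernel.
by move=> x x0; exact: hC.
Qed.

Lemma cvgy_bessel_kernel k nu s : 0 < s -> f k nu s x @[x --> +oo] --> 0.
Proof.
move=> s0; have [C C0 hC] := bessel_kernel_bound nu.
apply: norm_cvg0.
have : C * (x ^+ k * expR (- (s * x))) @[x --> (+oo : set_system R)] --> C * (0 : R).
  by apply: cvgM; [exact: cvg_cst|exact: cvgy_exprn_expRN].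
rewrite mulr0; apply: squeeze_cvgr; last exact: cvg_cst.
near=> x; rewrite normr_ge0/=; apply: hC.
by near: x; exact: nbhs_pinfty_gt.
Unshelve. all: end_near. Qed.

(** Integrate the derivative of [x^(k+1) J_nu(omega x) expR (- s x)], which vanishes at both ends,
    with [J_nu'] rewritten by [dbesselJ_up]. *)
Lemma bessel_laplace_up k nu s : 0 < s ->
  omega * A k.+1 nu.+1 s + s * A k.+1 nu s = (nu%:R + k.+1%:R) * A k nu s.
Proof.
move=> s0.
have i0 := integrable_half_lineZ (nu%:R + k.+1%:R) (integrable_bessel_kernel k nu s0).
have i1 := integrable_half_lineZ omega (integrable_bessel_kernel k.+1 nu.+1 s0).
have i2 := integrable_half_lineZ s (integrable_bessel_kernel k.+1 nu s0).
have i12 := integrable_half_lineD i1 i2.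
have : \int[mu]_(x in `]0, +oo[) ((nu%:R + k.+1%:R) * f k nu s x -
    (omega * f k.+1 nu.+1 s x + s * f k.+1 nu s x)) = 0 - 0.
  apply: (@integrable_FTC2_0y R (fun x => (nu%:R + k.+1%:R) * f k nu s x -
    (omega * f k.+1 nu.+1 s x + s * f k.+1 nu s x)) (f k.+1 nu s)).
  - move=> x _; apply: cvgB; last apply: cvgD;
      by apply: cvgM; [exact: cvg_cst|exact: continuous_bessel_kernel].
  - move=> x _; apply: (trigger_derive (is_derive_bessel_kernel k.+1 nu s x)).
    rewrite /f (_ : x ^+ k.+1 * (_ * dbesselJ _ _) = x ^+ k * (omega * x * dbesselJ nu (omega * x))).
      by rewrite dbesselJ_up exprS/=; ring.
    by rewrite exprS; ring.
  - rewrite -[X in _ --> X](_ : f k.+1 nu s 0 = 0); last first.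
      by rewrite /f expr0n !mul0r.
    exact/cvg_at_right_filter/continuous_bessel_kernel.
  - exact: cvgy_bessel_kernel.
  - exact: integrable_half_lineB.
rewrite subr0 RintegralB//= => /eqP; rewrite subr_eq0 => /eqP.
rewrite RintegralD//= !RintegralZl//; exact: integrable_bessel_kernel.
Qed.

(** The same computation at order [nu + 1], with [dbesselJ_down] to return to order [nu]. *)
Lemma bessel_laplace_down k nu s : 0 < s ->
  omega * A k.+1 nu s - s * A k.+1 nu.+1 s = (nu%:R - k%:R) * A k nu.+1 s.
Proof.
move=> s0.
have i0 := integrable_half_lineZ (nu%:R - k%:R) (integrable_bessel_kernel k nu.+1 s0).
have i1 := integrable_half_lineZ omega (integrable_bessel_kernel k.+1 nu s0).
have i2 := integrable_half_lineZ s (integrable_bessel_kernel k.+1 nu.+1 s0).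
have i12 := integrable_half_lineB i1 i2.
have : \int[mu]_(x in `]0, +oo[) ((omega * f k.+1 nu s x - s * f k.+1 nu.+1 s x) -
    (nu%:R - k%:R) * f k nu.+1 s x) = 0 - 0.
  apply: (@integrable_FTC2_0y R (fun x => (omega * f k.+1 nu s x - s * f k.+1 nu.+1 s x) -
    (nu%:R - k%:R) * f k nu.+1 s x) (f k.+1 nu.+1 s)).
  - move=> x _; apply: cvgB; first apply: cvgB;
      by apply: cvgM; [exact: cvg_cst|exact: continuous_bessel_kernel].
  - move=> x _; apply: (trigger_derive (is_derive_bessel_kernel k.+1 nu.+1 s x)).
    rewrite /f (_ : x ^+ k.+1 * (_ * dbesselJ _ _) = x ^+ k * (omega * x * dbesselJ nu.+1 (omega * x))).
      by rewrite dbesselJ_down exprS -!natr1/=; ring.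
    by rewrite exprS; ring.
  - rewrite -[X in _ --> X](_ : f k.+1 nu.+1 s 0 = 0); last first.
      by rewrite /f expr0n !mul0r.
    exact/cvg_at_right_filter/continuous_bessel_kernel.
  - exact: cvgy_bessel_kernel.
  - exact: integrable_half_lineB.
rewrite subr0 RintegralB//= => /eqP; rewrite subr_eq0 => /eqP.
rewrite RintegralB//= !RintegralZl//; exact: integrable_bessel_kernel.
Qed.

(** Without a power of [x] the boundary term [J_0(0) = 1] survives. *)
Lemma bessel_laplace01 s : 0 < s -> omega * A 0 1 s + s * A 0 0 s = 1.
Proof.
move=> s0.
have i1 := integrable_half_lineZ omega (integrable_bessel_kernel 0 1 s0).
have i2 := integrable_half_lineZ s (integrable_bessel_kernel 0 0 s0).
have : \int[mu]_(x in `]0, +oo[) (omega * f 0 1 s x + s * f 0 0 s x) = - 0 - (- 1).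
  apply: (@integrable_FTC2_0y R (fun x => omega * f 0 1 s x + s * f 0 0 s x)
    (fun x => - f 0 0 s x)).
  - move=> x _; apply: cvgD;
      by apply: cvgM; [exact: cvg_cst|exact: continuous_bessel_kernel].
  - move=> x _; apply: (trigger_derive (is_deriveN (is_derive_bessel_kernel 0 0 s x))).
    by rewrite /f /= !expr0; ring.
  - rewrite -[X in _ --> X](_ : - f 0 0 s 0 = - 1); last first.
      by rewrite /f !mulr0 besselJ00 oppr0 expR0 expr0 !mulr1.
    by apply: cvg_at_right_filter; apply: cvgN; exact: continuous_bessel_kernel.
  - by apply: cvgN; exact: cvgy_bessel_kernel.
  - exact: integrable_half_lineD.
rewrite oppr0 sub0r opprK RintegralD//= !RintegralZl//; exact: integrable_bessel_kernel.
Qed.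

(** Integrate [J_(nu+1)' = (J_nu - J_(nu+2)) / 2] against the damping factor; [J_(nu+1)(0) = 0].
    From orders 0 and 1 this reaches every order. *)
Lemma bessel_laplace0SS nu s : 0 < s ->
  omega / 2 * (A 0 nu s - A 0 nu.+2 s) = s * A 0 nu.+1 s.
Proof.
move=> s0.
have i1 := integrable_bessel_kernel 0 nu s0.
have i2 := integrable_bessel_kernel 0 nu.+2 s0.
have i12 := integrable_half_lineZ (omega / 2) (integrable_half_lineB i1 i2).
have i3 := integrable_half_lineZ s (integrable_bessel_kernel 0 nu.+1 s0).
have : \int[mu]_(x in `]0, +oo[) (omega / 2 * (f 0 nu s x - f 0 nu.+2 s x) - s * f 0 nu.+1 s x) = 0 - 0.
  apply: (@integrable_FTC2_0y R (fun x => omega / 2 * (f 0 nu s x - f 0 nu.+2 s x)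
    - s * f 0 nu.+1 s x) (f 0 nu.+1 s)).
  - move=> x _; apply: cvgB; (apply: cvgM; first exact: cvg_cst);
      last exact: continuous_bessel_kernel.
    by apply: cvgB; exact: continuous_bessel_kernel.
  - move=> x _; apply: (trigger_derive (is_derive_bessel_kernel 0 nu.+1 s x)).
    by rewrite /f /= !expr0; field.
  - rewrite -[X in _ --> X](_ : f 0 nu.+1 s 0 = 0); last first.
      by rewrite /f !mulr0 besselJS0 mulr0 mul0r.
    by apply: cvg_at_right_filter; exact: continuous_bessel_kernel.
  - exact: cvgy_bessel_kernel.
  - exact: integrable_half_lineB.
rewrite subr0 RintegralB//= => /eqP; rewrite subr_eq0 => /eqP.
rewrite !RintegralZl//=; last 2 first.
- exact: integrable_bessel_kernel.
- exact: integrable_half_lineB.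
by rewrite RintegralB.
Qed.

End bessel_laplace.

(** * Limits of the damped integrals as [s] tends to 0 from the right *)

Section bessel_laplace_limits.
Context {R : realType}.
Notation mu := (@lebesgue_measure R).
Implicit Types (s t x : R) (nu k : nat).

Variable omega : R.
Hypothesis omega0 : 0 < omega.

Notation f := (bessel_kernel omega).
Notation A := (bessel_laplace omega).

Lemma bessel_laplace_bound nu : exists2 C : R, 0 <= C &
  forall s, 0 < s -> `|A 0 nu s| <= C / s.
Proof.
have [C C0 hC] := bessel_kernel_bound omega0 nu; exists C => // s s0.
have if0 := integrable_bessel_kernel omega0 0 nu s0.
have ie := integrable_half_lineZ C (integrable_exprn_expRN 0 s0).
apply: (@le_trans _ _ (\int[mu]_(x in `]0, +oo[) `|f 0 nu s x|)).
  exact: le_normr_Rintegral.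
apply: (@le_trans _ _ (\int[mu]_(x in `]0, +oo[) (C * (x ^+ 0 * expR (- (s * x)))))).
  apply: le_integral_half_line ie _; first exact: integrable_norm.
  by move=> x x0; exact: hC.
rewrite RintegralZl//; last exact: integrable_exprn_expRN.
have := integral_exprn_expRN 0 s0; rewrite fact0 expr1 div1r => /(congr1 fine)/= h.
by rewrite -h.
Qed.

Lemma is_derive_bessel_laplace00 s : 0 < s -> is_derive s 1 (A 0 0) (- A 1 0 s).
Proof.
move=> s0; have [C C0 hC] := bessel_kernel_bound omega0 0.
have dk t x : is_derive t 1 (fun t => f 0 0 t x) (- f 1 0 t x).
  rewrite /f expr0 mul1r expr1; move: (besselJ 0 (omega * x)) => j.
  by apply: trigger_derive; rewrite /GRing.scale/=; ring.
have d1E t x : partial1of2 (f 0 0) t x = - f 1 0 t x.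
  by rewrite partial1of2E; apply: derive_val.
have s2 : 0 < s / 2 by rewrite divr_gt0.
(* For [t > s / 2] the derivative in [t] is dominated by this function on the half-line; the
   absolute value makes [G] nonnegative for every real [x]. *)
pose G x := C * `|x ^+ 1 * expR (- (s / 2 * x))|.
have iG : mu.-integrable `]0, +oo[ (EFin \o G).
  apply: integrable_half_lineZ; apply: integrable_norm.
  exact: integrable_exprn_expRN.
have Is : `]s / 2, s * 2[%classic s by rewrite /= in_itv/=; lra.
have intf t : `]s / 2, s * 2[%classic t -> mu.-integrable `]0, +oo[ (EFin \o f 0 0 t).
  rewrite /= in_itv/= => /andP[t0 _]; apply: integrable_bessel_kernel => //.
  exact: lt_trans t0.
have derf t x : `]s / 2, s * 2[%classic t -> `]0, +oo[%classic x -> derivable ((f 0 0)^~ x) t 1.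
  by move=> _ _; have [] := dk t x.
have G0 x : 0 <= G x by rewrite mulr_ge0.
have Gub t x : `]s / 2, s * 2[%classic t -> `]0, +oo[%classic x -> `|partial1of2 (f 0 0) t x| <= G x.
  rewrite /= !in_itv/= andbT => /andP[t0 _] x0; rewrite d1E normrN /G.
  apply: (le_trans (hC 1%N t x x0)); rewrite ler_wpM2l// ger0_norm; last first.
    by rewrite mulr_ge0 ?expR_ge0// exprn_ge0// ltW.
  apply: ler_wpM2l; first exact/exprn_ge0/ltW.
  by rewrite ler_expR lerN2; apply: ler_wpM2r; exact: ltW.
have mD : measurable (`]0%R, +oo[ : set (measurableTypeR R)) by exact: measurable_itv.
have D1 := @derivable_under_integral R _ _ mu (f 0 0) _ mD s _ _ Is intf derf G G0 iG Gub.
have D2 := @differentiation_under_integral R _ _ mu (f 0 0) _ mD s _ _ Is intf derf G G0 iG Gub.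
apply: DeriveDef => //; rewrite -derive1E D2.
transitivity (\int[mu]_(x in `]0, +oo[) (- 1 * f 1 0 s x)).
  by apply: eq_integral_half_line => x _; rewrite -[LHS]/(partial1of2 (f 0 0) s x) d1E mulN1r.
by rewrite RintegralZl ?mulN1r//; exact: integrable_bessel_kernel.
Qed.

Lemma bessel_laplace_norm_gt0 s : 0 < omega ^+ 2 + s ^+ 2.
Proof. by rewrite ltr_pwDl ?exprn_gt0// sqr_ge0. Qed.

(** [bessel_laplace_up] and [bessel_laplace_down] are a linear system in [A k.+1 nu.+1 s] and
    [A k.+1 nu s]; this lemma and the next one solve it. *)
Lemma bessel_laplaceSS k nu s : 0 < s -> A k.+1 nu.+1 s =
  (omega * (nu%:R + k.+1%:R) * A k nu s - s * (nu%:R - k%:R) * A k nu.+1 s) / (omega ^+ 2 + s ^+ 2).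
Proof.
move=> s0; have n0 := bessel_laplace_norm_gt0 s.
have h1 := bessel_laplace_up omega0 k nu s0; have h2 := bessel_laplace_down omega0 k nu s0.
apply: (@mulIf _ (omega ^+ 2 + s ^+ 2)); rewrite ?gt_eqF// divfK ?gt_eqF//.
by rewrite -!mulrA -h1 -h2; ring.
Qed.

Lemma bessel_laplaceS k nu s : 0 < s -> A k.+1 nu s =
  (omega * (nu%:R - k%:R) * A k nu.+1 s + s * (nu%:R + k.+1%:R) * A k nu s) / (omega ^+ 2 + s ^+ 2).
Proof.
move=> s0; have n0 := bessel_laplace_norm_gt0 s.
have h1 := bessel_laplace_up omega0 k nu s0; have h2 := bessel_laplace_down omega0 k nu s0.
apply: (@mulIf _ (omega ^+ 2 + s ^+ 2)); rewrite ?gt_eqF// divfK ?gt_eqF//.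
by rewrite -!mulrA -h1 -h2; ring.
Qed.

(* [sqrt (omega^2 + s^2) A 0 0 s] has derivative 0, and tends to 1 at infinity. *)
Lemma bessel_laplace00 s : 0 < s -> A 0 0 s = (Num.sqrt (omega ^+ 2 + s ^+ 2))^-1.
Proof.
move=> s0; pose g t := Num.sqrt (omega ^+ 2 + t ^+ 2) * A 0 0 t.
have sq_gt0 t : 0 < Num.sqrt (omega ^+ 2 + t ^+ 2) by rewrite sqrtr_gt0 bessel_laplace_norm_gt0.
have dg t : 0 < t -> is_derive t 1 g 0.
  move=> t0.
  have d1 : is_derive t 1 (fun t => omega ^+ 2 + t ^+ 2) (2 * t).
    by apply: trigger_derive; rewrite /GRing.scale/=; ring.
  have d2 := @is_derive1_comp R Num.sqrt (fun t => omega ^+ 2 + t ^+ 2) t _ _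
    (is_derive1_sqrt (bessel_laplace_norm_gt0 t)) d1.
  apply: (trigger_derive (is_deriveM d2 (is_derive_bessel_laplace00 t0))).
  (* At [k = nu = 0] the coefficient of [A 0 1 t] is 0, which leaves
     [A 1 0 t = t A 0 0 t / (omega^2 + t^2)], a closed differential equation for [A 0 0]. *)
  rewrite /GRing.scale/= bessel_laplaceS//.
  have sE : omega ^+ 2 + t ^+ 2 = Num.sqrt (omega ^+ 2 + t ^+ 2) ^+ 2.
    by rewrite sqr_sqrtr// ltW// bessel_laplace_norm_gt0.
  rewrite {2}sE; field.
  by rewrite gt_eqF.
have gE t : s < t -> g s = g t.
  move=> st; apply/esym/eqP; rewrite -subr_eq0; apply/eqP.
  have [z zst||c _ ->] := @MVT _ g (fun=> 0) s t st.
  - by apply: dg; move: zst; rewrite in_itv/= => /andP[sz _]; exact: lt_trans sz.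
  - apply: derivable_within_continuous => z; rewrite in_itv/= => /andP[sz _].
    by have [] := dg z (lt_le_trans s0 sz).
  - by rewrite mul0r.
suff g1 : g t @[t --> +oo] --> (1 : R).
  have g2 : g t @[t --> +oo] --> g s.
    apply: cvg_near_cst; near=> t; apply/esym/gE.
    by near: t; apply: nbhs_pinfty_gt; exact: num_real.
  have h : g s = 1 by exact: cvg_unique g2 g1.
  by rewrite -[RHS]mulr1 -h /g mulrA mulVf ?mul1r// gt_eqF.
have [C C0 hC] := bessel_laplace_bound 1.
have inv0 : (t : R)^-1 @[t --> +oo] --> 0.
  by apply/gtr0_cvgV0 => //; exact: nbhs_pinfty_gt.
have A0 : A 0 1 t @[t --> +oo] --> 0.
  apply: norm_cvg0.
  have : C * t^-1 @[t --> (+oo : set_system R)] --> C * (0 : R).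
    by apply: cvgM; [exact: cvg_cst|].
  rewrite mulr0; apply: squeeze_cvgr; last exact: cvg_cst.
  near=> t; rewrite normr_ge0/=; apply: hC.
  by near: t; exact: nbhs_pinfty_gt.
(* For [0 < t] this product is [g t], with [t] moved out of the square root and [t A 0 0 t] written
   as [1 - omega A 0 1 t]. *)
have : Num.sqrt ((omega * t^-1) ^+ 2 + 1) * (1 - omega * A 0 1 t)
    @[t --> (+oo : set_system R)] --> Num.sqrt ((omega * 0) ^+ 2 + 1) * (1 - omega * 0).
  apply: cvgM; last first.
    by apply: cvgB; [exact: cvg_cst|apply: cvgM => //; exact: cvg_cst].
  apply: (cvg_comp _ Num.sqrt); last exact: sqrt_continuous.
  apply: cvgD; last exact: cvg_cst.
  apply: (cvg_comp _ (fun x => x ^+ 2)); last exact: exprn_continuous.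
  by apply: cvgM => //; exact: cvg_cst.
rewrite !mulr0 expr0n/= add0r sqrtr1 subr0 mul1r; apply: cvg_trans.
apply: near_eq_cvg; near=> t.
have t0 : 0 < t by near: t; exact: nbhs_pinfty_gt.
rewrite (_ : 1 - omega * A 0 1 t = t * A 0 0 t); last first.
  by rewrite -(bessel_laplace01 omega0 t0) addrAC subrr add0r.
rewrite mulrA /g; congr (_ * _).
rewrite -[X in _ * X](ger0_norm (ltW t0)) -sqrtr_sqr -sqrtrM; last first.
  by rewrite addr_ge0// sqr_ge0.
by congr Num.sqrt; field; rewrite gt_eqF.
Unshelve. all: end_near. Qed.

(** The solved recurrences at [s = 0], with the powers of [omega] removed. The second one is only
    used at order 0, where [nu - k] becomes [- k]. *)
Fixpoint hankel_moment k nu : R :=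
  if k is k'.+1 then
    if nu is nu'.+1 then (nu'%:R + k'.+1%:R) * hankel_moment k' nu'
    else - k'%:R * hankel_moment k' 1
  else 1.

(** Order 0 is the closed form, order 1 comes from [bessel_laplace01], and the recurrence of step
    two gives the others, since [s A 0 nu.+1 s] tends to 0. *)
Lemma cvg_bessel_laplace0 nu : A 0 nu s @[s --> 0^'+] --> omega^-1.
Proof.
have s0 : s @[s --> (0 : R)^'+] --> (0 : R).
  by apply: cvg_at_right_filter; exact: cvg_id.
suff [] : A 0 nu s @[s --> 0^'+] --> omega^-1 /\ A 0 nu.+1 s @[s --> 0^'+] --> omega^-1 by [].
elim: nu => [|nu [h0 h1]]; last first.
  split; first exact: h1.
  have : A 0 nu s - 2 / omega * (s * A 0 nu.+1 s) @[s --> 0^'+] -->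
      omega^-1 - 2 / omega * (0 * omega^-1).
    apply: cvgB; first exact: h0.
    by apply: cvgM; [exact: cvg_cst|exact: cvgM].
  rewrite mul0r mulr0 subr0; apply: cvg_trans; apply: near_eq_cvg; near=> s.
  have sp : 0 < s by near: s; exact: nbhs_right_gt.
  by rewrite -bessel_laplace0SS//; field; rewrite gt_eqF.
have h0 : A 0 0 s @[s --> 0^'+] --> omega^-1.
  have : (Num.sqrt (omega ^+ 2 + s ^+ 2))^-1 @[s --> 0^'+] --> (Num.sqrt (omega ^+ 2 + 0 ^+ 2))^-1.
    apply: cvgV; first by rewrite gt_eqF// sqrtr_gt0 bessel_laplace_norm_gt0.
    apply: (cvg_comp _ Num.sqrt); last exact: sqrt_continuous.
    apply: cvgD; first exact: cvg_cst.
    by apply: (cvg_comp _ (fun x => x ^+ 2) s0); exact: exprn_continuous.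
  rewrite expr0n/= addr0 sqrtr_sqr gtr0_norm//; apply: cvg_trans; apply: near_eq_cvg; near=> s.
  by rewrite bessel_laplace00//; near: s; exact: nbhs_right_gt.
split; first exact: h0.
have : (1 - s * A 0 0 s) / omega @[s --> 0^'+] --> (1 - 0 * omega^-1) / omega.
  apply: cvgM; last exact: cvg_cst.
  by apply: cvgB; [exact: cvg_cst|exact: cvgM].
rewrite mul0r subr0 div1r; apply: cvg_trans; apply: near_eq_cvg; near=> s.
have sp : 0 < s by near: s; exact: nbhs_right_gt.
by rewrite -(bessel_laplace01 omega0 sp); field; rewrite gt_eqF.
Unshelve. all: end_near. Qed.

(** Pass to the limit in the solved recurrences. The target is first rewritten in the shape of that
    limit, with its vanishing term kept as a product by 0. *)
Lemma cvg_bessel_laplace k nu :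
  A k nu s @[s --> 0^'+] --> hankel_moment k nu / omega ^+ k.+1.
Proof.
have s0 : s @[s --> (0 : R)^'+] --> (0 : R).
  by apply: cvg_at_right_filter; exact: cvg_id.
have cden : (omega ^+ 2 + s ^+ 2)^-1 @[s --> 0^'+] --> (omega ^+ 2 + 0 ^+ 2)^-1.
  apply: cvgV; first by rewrite gt_eqF// bessel_laplace_norm_gt0.
  apply: cvgD; first exact: cvg_cst.
  by apply: (cvg_comp _ (fun x => x ^+ 2) s0); exact: exprn_continuous.
have o0 : omega != 0 by rewrite gt_eqF.
elim: k nu => [|k ih] nu; first by rewrite div1r expr1; exact: cvg_bessel_laplace0.
case: nu => [|nu].
  have -> : hankel_moment k.+1 0 / omega ^+ k.+2 =
    (omega * (0%:R - k%:R) * (hankel_moment k 1 / omega ^+ k.+1)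
      + 0 * (0%:R + k.+1%:R) * (hankel_moment k 0 / omega ^+ k.+1)) / (omega ^+ 2 + 0 ^+ 2).
    by rewrite /= !exprS; field; rewrite o0 expf_neq0.
  have : (omega * (0%:R - k%:R) * A k 1 s + s * (0%:R + k.+1%:R) * A k 0 s) / (omega ^+ 2 + s ^+ 2)
    @[s --> 0^'+] --> (omega * (0%:R - k%:R) * (hankel_moment k 1 / omega ^+ k.+1)
      + 0 * (0%:R + k.+1%:R) * (hankel_moment k 0 / omega ^+ k.+1)) / (omega ^+ 2 + 0 ^+ 2).
    apply: cvgM => //; apply: cvgD; apply: cvgM => //; first exact: cvg_cst.
    by apply: cvgM => //; exact: cvg_cst.
  apply: cvg_trans; apply: near_eq_cvg; near=> s.
  by rewrite bessel_laplaceS//; near: s; exact: nbhs_right_gt.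
have -> : hankel_moment k.+1 nu.+1 / omega ^+ k.+2 =
    (omega * (nu%:R + k.+1%:R) * (hankel_moment k nu / omega ^+ k.+1)
      - 0 * (nu%:R - k%:R) * (hankel_moment k nu.+1 / omega ^+ k.+1)) / (omega ^+ 2 + 0 ^+ 2).
  by rewrite /= !exprS; field; rewrite o0 expf_neq0.
have : (omega * (nu%:R + k.+1%:R) * A k nu s - s * (nu%:R - k%:R) * A k nu.+1 s) / (omega ^+ 2 + s ^+ 2)
    @[s --> 0^'+] --> (omega * (nu%:R + k.+1%:R) * (hankel_moment k nu / omega ^+ k.+1)
      - 0 * (nu%:R - k%:R) * (hankel_moment k nu.+1 / omega ^+ k.+1)) / (omega ^+ 2 + 0 ^+ 2).
  apply: cvgM => //; apply: cvgB; apply: cvgM => //; first exact: cvg_cst.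
  by apply: cvgM => //; exact: cvg_cst.
apply: cvg_trans; apply: near_eq_cvg; near=> s.
by rewrite bessel_laplaceSS//; near: s; exact: nbhs_right_gt.
Unshelve. all: end_near. Qed.

Lemma abel_integral_bessel k nu : is_abel_integral
  (fun x => x ^+ k * besselJ nu (omega * x)) (hankel_moment k nu / omega ^+ k.+1).
Proof.
split=> [s s0|]; last exact: cvg_bessel_laplace.
exact: integrable_bessel_kernel.
Qed.

End bessel_laplace_limits.

(** * Comparison of the two families of moments *)

Section gamma_recurrence.
#[local] Opaque euler_integral.
#[local] Opaque cosh_integral.
Context {R : realType}.
Notation mu := (@lebesgue_measure R).
Implicit Types (x : R) (nu k d m : nat).

Lemma Gamma_gt0E x : 0 < x -> Gamma x = euler_integral x.
Proof. by move=> x0; rewrite /Gamma x0. Qed.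

(* [Gamma x] and [(Gamma x)^-1] are 0 at the poles, so this holds there too. *)
Lemma invGamma_rec x : x <= 0 -> (Gamma x)^-1 = x * (Gamma (x + 1))^-1.
Proof.
move=> x0; rewrite {1}/Gamma ltNge x0/=.
have [x1|x1] := ltP (- 1) x.
  have -> : Num.truncn (- x) = 0%N by apply: truncn_def; lra.
  rewrite big_ord1 addr0 Gamma_gt0E; last by lra.
  by rewrite invfM invrK mulrC.
(* For [x <= -1] the product for [x] has one factor more than that for [x + 1], namely [x]
   itself. *)
have -> : Num.truncn (- x) = (Num.truncn (- (x + 1))).+1.
  apply: truncn_def; have /andP[h1 h2] : (Num.truncn (- (x + 1)))%:R <= - (x + 1) < (Num.truncn (- (x + 1))).+1%:R.
    by apply: truncn_itv; lra.
  by rewrite -![_.+1%:R]natr1 in h2 *; apply/andP; split; lra.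
rewrite /Gamma ltNge (_ : x + 1 <= 0)/=; last by lra.
set m := (Num.truncn _).+1.
rewrite big_ord_recl/= addr0 (_ : x + m.+1%:R = x + 1 + m%:R); last by rewrite -natr1; ring.
have -> : \prod_(i < m) (x + (bump 0 i)%:R) = \prod_(i < m) (x + 1 + i%:R).
  by apply: eq_bigr => i _; rewrite /bump leq0n add1n -natr1; ring.
by rewrite !invfM !invrK mulrCA.
Qed.

Lemma Gamma_half_rec k : Gamma ((k%:R + 1) / 2 + 1 : R) = (k%:R + 1) / 2 * Gamma ((k%:R + 1) / 2 : R).
Proof.
have k0 : 0 < (k%:R + 1) / 2 :> R by rewrite divr_gt0// ltr_wpDl.
by rewrite !Gamma_gt0E ?addr_gt0// euler_integral_half_rec.
Qed.

Lemma Gamma_half_neq0 k : Gamma ((k%:R + 1) / 2 : R) != 0.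
Proof.
have k0 : 0 < (k%:R + 1) / 2 :> R by rewrite divr_gt0// ltr_wpDl.
by rewrite Gamma_gt0E// gt_eqF// euler_integral_half_gt0.
Qed.

Lemma hankel_momentS0 k : hankel_moment k.+1 0 = - k%:R * hankel_moment k 1 :> R.
Proof. by []. Qed.

Lemma hankel_momentSS k nu :
  hankel_moment k.+1 nu.+1 = (nu%:R + k.+1%:R) * hankel_moment k nu :> R.
Proof. by []. Qed.

(** Raising both indices raises only the upper Gamma argument by 1. Going from [(k, 1)] to
    [(k + 1, 0)] lowers only the lower one, to [- k / 2 <= 0], where [invGamma_rec] holds even at
    the poles. *)
Lemma hankel_momentE k nu : hankel_moment k nu =
  2 ^+ k * (Gamma ((nu%:R + k%:R + 1) / 2) / Gamma ((nu%:R - k%:R + 1) / 2)) :> R.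
Proof.
elim: k nu => [|k ih] nu.
  by rewrite addr0 subr0 expr0 mul1r divff// Gamma_half_neq0.
case: nu => [|nu]; rewrite ?hankel_momentS0 ?hankel_momentSS ih.
  rewrite (_ : (0 + k.+1%:R + 1) / 2 = (1 + k%:R + 1) / 2); last by rewrite -natr1; ring.
  rewrite (_ : (1 - k%:R + 1) / 2 = (0 - k.+1%:R + 1) / 2 + 1); last by rewrite -natr1; field.
  rewrite [X in _ = _ * (_ * X)]invGamma_rec; last first.
    by rewrite -natr1; have := ler0n R k; lra.
  move: (Gamma ((0 - k.+1%:R + 1) / 2 + 1))^-1 (Gamma ((1 + k%:R + 1) / 2)) => G H.
  by rewrite exprS -natr1; field.
rewrite (_ : (nu.+1%:R - k.+1%:R + 1) / 2 = (nu%:R - k%:R + 1) / 2); last by rewrite -!natr1; ring.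
rewrite (_ : (nu.+1%:R + k.+1%:R + 1) / 2 = ((nu + k)%:R + 1) / 2 + 1); last by rewrite natrD -!natr1; field.
rewrite Gamma_half_rec exprS natrD.
move: (Gamma ((nu%:R - k%:R + 1) / 2))^-1 (Gamma ((nu%:R + k%:R + 1) / 2)) => G H.
by rewrite -natr1; field.
Qed.

(** The recurrences lead down to [M_{1,0}], which carries the factor [- 0]. *)
Lemma hankel_moment_odd d nu : hankel_moment (nu + d.*2.+1) nu = 0 :> R.
Proof.
elim: d nu => [|d ihd] nu; elim: nu => [|nu ih]; rewrite ?addSn ?hankel_momentSS ?ih ?mulr0//.
  by rewrite hankel_momentS0 oppr0 mul0r.
by rewrite add0n hankel_momentS0 doubleS (ihd 1%N) mulr0.
Qed.

(** The same descent ends at [M_{0,0} = 1], matched by [cosh_integral 0 1 = pi / 2]. Each passage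
    through order 0 contributes one sign. *)
Lemma hankel_moment_even d nu : hankel_moment (nu + d.*2) nu =
  2 / pi * (-1) ^+ d * ((nu + d.*2)`!%:R * cosh_integral nu%:R (nu + d.*2).+1) :> R.
Proof.
have pi0 : pi != 0 :> R by rewrite gt_eqF// pi_gt0.
have step e n : hankel_moment (n + e.*2) n =
    2 / pi * (-1) ^+ e * ((n + e.*2)`!%:R * cosh_integral n%:R (n + e.*2).+1) :> R ->
    hankel_moment (n.+1 + e.*2) n.+1 =
    2 / pi * (-1) ^+ e * ((n.+1 + e.*2)`!%:R * cosh_integral n.+1%:R (n.+1 + e.*2).+1) :> R.
  move=> h; rewrite addSn hankel_momentSS h factS natrM.
  have := @cosh_integral_rec R n%:R (n + e.*2); rewrite !natr1 => hr.
  have {}hr := hr _.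
  rewrite [RHS](_ : _ = 2 / pi * (-1) ^+ e * (n + e.*2)`!%:R *
    ((n + e.*2).+1%:R * cosh_integral n.+1%:R (n + e.*2).+2)); last by ring.
  rewrite hr; first by ring.
  by rewrite ger0_norm// ltr_nat ltnS leq_addr.
elim: d nu => [|d ihd] nu; elim: nu => [|nu ih]; rewrite ?step//.
  rewrite add0n double0 cosh_integral01 expr0 fact0.
  by move: (@pi R) pi0 => p p0 /=; field.
rewrite add0n doubleS hankel_momentS0 (ihd 1%N) add1n.
(* As [cosh] is even, the recurrence at [a = -1] links order 1 to order 0, with the factor [2d + 1]
   of [hankel_momentS0]. *)
have := @cosh_integral_rec R (-1) d.*2.+1.
rewrite addNr normrN normr1 ltr1n => /(_ isT).
have -> : cosh_integral (-1) d.*2.+2 = cosh_integral 1 d.*2.+2 :> R.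
  by apply: eq_integral_half_line => t _; rewrite mulN1r mul1r coshN.
rewrite (factS d.*2.+1) natrM => h.
rewrite [RHS](_ : _ = 2 / pi * (-1) ^+ d.+1 * d.*2.+1`!%:R *
  (d.*2.+2%:R * cosh_integral 0 d.*2.+3)); last by ring.
rewrite h exprS -[1%:R]/(1 : R); move: (cosh_integral 1 _) => c.
by rewrite -!natr1; ring.
Qed.

End gamma_recurrence.

(** * The quadrature rule *)

Section complex_polynomials.

Lemma is_derive_horner (K : numFieldType) (p : {poly K}) (z : K) :
  is_derive (z : K^o) 1 (horner p : K^o -> K^o) p^`().[z].
Proof.
elim/poly_ind: p => [|p c ih].
  rewrite deriv0 horner0 (_ : horner 0 = cst 0); first exact: is_derive_cst.
  by apply/funext => y; rewrite horner0.
rewrite (_ : horner _ = (horner p : K^o -> K^o) * id + cst c); last first.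
  by apply/funext => y; rewrite !hornerE.
apply: is_derive_eq; rewrite /GRing.scale/=.
by rewrite derivD derivM derivX derivC !hornerE addrC mulrC.
Qed.

Lemma derive1n_horner (K : numFieldType) (p : {poly K}) k :
  derive1n k (fun z : K => p.[z] : K^o) = fun z : K => p^`(k).[z] : K^o.
Proof.
elim: k => [|k ih]; first by apply/funext => z; rewrite derivn0.
apply/funext => z; rewrite derive1nS ih derive1E derivnS.
by have := is_derive_horner p^`(k) z => ?; exact: derive_val.
Qed.

Lemma derive1n_horner0 (K : numFieldType) (p : {poly K}) k :
  derive1n k (fun z : K => p.[z] : K^o) 0 = k`!%:R * p`_k.
Proof.
by rewrite derive1n_horner horner_coef0 coef_derivn addn0 ffactnn mulr_natl.
Qed.

End complex_polynomials.

Section complex_exponentials.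
Context {R : realType}.
Implicit Types (a b s : R) (k : nat).

Lemma cisD a b : cis (a + b) = cis a * cis b.
Proof.
rewrite /cis cosD sinD; apply/eqP; rewrite eq_complex /=.
by apply/andP; split; apply/eqP; ring.
Qed.

Lemma cis0 : cis 0 = 1 :> R[i].
Proof. by rewrite /cis cos0 sin0. Qed.

Lemma cisX a k : cis a ^+ k = cis (k%:R * a).
Proof.
elim: k => [|k ih]; first by rewrite expr0 mul0r cis0.
by rewrite exprS ih -cisD -nat1r mulrDl mul1r.
Qed.

Lemma cisDN a : cis a + cis (- a) = real_complex R (2 * cos a).
Proof.
rewrite /cis cosN sinN; apply/eqP; rewrite eq_complex /=.
by rewrite subrr eqxx andbT; apply/eqP; ring.
Qed.

(** Polar form of a node: the angle of its powers can then be added to the phase of the weight. *)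
Lemma imag_nodeE s (sg : bool) :
  (0 +i* ((-1) ^+ sg * s))%C = cis ((-1) ^+ sg * (pi / 2)) * real_complex R s.
Proof.
case: sg; rewrite ?expr1 ?expr0 ?mulN1r ?mul1r /cis ?cosN ?sinN cos_pihalf sin_pihalf;
  by apply/eqP; rewrite eq_complex /=; apply/andP; split; apply/eqP; ring.
Qed.

Lemma cos_mulpi k : cos (k%:R * pi) = (-1) ^+ k :> R.
Proof.
elim: k => [|k ih]; first by rewrite mul0r cos0.
by rewrite -natr1 mulrDl mul1r cosDpi ih exprS mulN1r.
Qed.

Lemma cos_odd_pihalf k : cos (k.*2.+1%:R * pi / 2) = 0 :> R.
Proof.
rewrite (_ : _ * pi / 2 = k%:R * pi + pi / 2); last first.
  by rewrite -natr1 -mul2n natrM; field.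
rewrite cosDpihalf; apply/eqP; rewrite oppr_eq0.
have := cos2Dsin2 (k%:R * pi : R); rewrite cos_mulpi sqrr_sign.
by move/eqP; rewrite -[X in _ == X]addr0 (inj_eq (addrI _)) sqrf_eq0.
Qed.

End complex_exponentials.

(** * Linearity of the Abel integral *)

Section abel_linear.
Context {R : realType}.
Implicit Types (g : R -> R) (l : R).

Lemma is_abel_integral0 : is_abel_integral (fun=> 0 : R) 0.
Proof.
split=> [s _|].
  by apply: eq_integrable_half_line (integrable_half_lineZ 0 (integrable_exprn_expRN 0 ltr01)) => t _; rewrite !mul0r.
under eq_fun do (under eq_Rintegral do rewrite mul0r).
by rewrite /Rintegral integral0; exact: cvg_cst.
Qed.

Lemma is_abel_integralZD g1 l1 g2 l2 c : is_abel_integral g1 l1 -> is_abel_integral g2 l2 ->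
  is_abel_integral (fun x => c * g1 x + g2 x) (c * l1 + l2).
Proof.
move=> [i1 h1] [i2 h2]; split=> [s s0|].
  apply: (eq_integrable_half_line _ (integrable_half_lineD (integrable_half_lineZ c (i1 s s0)) (i2 s s0))).
  by move=> t _; rewrite mulrDl mulrA.
have h : c * \int[@lebesgue_measure R]_(x in `]0, +oo[) (g1 x * expR (- (s * x))) +
    \int[@lebesgue_measure R]_(x in `]0, +oo[) (g2 x * expR (- (s * x))) @[s --> (0 : R)^'+]
    --> c * l1 + l2.
  by apply: cvgD => //; apply: cvgM => //; exact: cvg_cst.
apply: cvg_trans h; apply: near_eq_cvg; near=> s.
have s0 : 0 < s by near: s; exact: nbhs_right_gt.
rewrite -RintegralZl//; last exact: i1.
rewrite -RintegralD//; last exact: i2.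
  by apply: eq_integral_half_line => t _; rewrite mulrDl mulrA.
exact: (integrable_half_lineZ c (i1 s s0)).
Unshelve. all: end_near. Qed.

Lemma is_abel_integral_sum n (c : nat -> R) (g : nat -> R -> R) (l : nat -> R) :
  (forall i, is_abel_integral (g i) (l i)) ->
  is_abel_integral (fun x => \sum_(i < n) c i * g i x) (\sum_(i < n) c i * l i).
Proof.
move=> h; elim: n => [|n ih].
  rewrite big_ord0; under eq_fun do rewrite big_ord0; exact: is_abel_integral0.
rewrite big_ord_recr/= addrC; under eq_fun do rewrite big_ord_recr/= addrC.
exact: is_abel_integralZD.
Qed.

End abel_linear.

(** * Hankel transforms of polynomials, and conjugate pairs of nodes *)

Section hankel_quadrature.
Context {R : realType}.
Notation C := (real_complex R).

(** The range [n] may exceed the size of [p], to match the index range on the quadrature side. *)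
Lemma is_hankel_transform_poly (nu : nat) (omega : R) (p : {poly R[i]}) n : 0 < omega ->
  (size p <= n)%N -> is_hankel_transform nu (fun z => p.[z]) omega
    (\sum_(k < n) p`_k * C (hankel_moment k nu / omega ^+ k.+1)).
Proof.
move=> omega0 pn.
have ReM (z : R[i]) (r : R) : complex.Re (z * C r) = complex.Re z * r.
  by case: z => a b /=; rewrite mulr0 subr0.
have ImM (z : R[i]) (r : R) : complex.Im (z * C r) = complex.Im z * r.
  by case: z => a b /=; rewrite mulr0 add0r mulrC.
have ReS m (F : nat -> R[i]) : complex.Re (\sum_(i < m) F i) = \sum_(i < m) complex.Re (F i).
  by elim: m => [|m ih]; rewrite ?big_ord0// !big_ord_recr/= -ih; case: (\sum_(i < m) F i) => ? ?; case: (F m).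
have ImS m (F : nat -> R[i]) : complex.Im (\sum_(i < m) F i) = \sum_(i < m) complex.Im (F i).
  by elim: m => [|m ih]; rewrite ?big_ord0// !big_ord_recr/= -ih; case: (\sum_(i < m) F i) => ? ?; case: (F m).
have E (x : R) : p.[C x] * C (besselJ nu (omega * x)) =
    \sum_(k < n) p`_k * C (x ^+ k * besselJ nu (omega * x)).
  rewrite (horner_coef_wide _ pn) mulr_suml; apply: eq_bigr => k _.
  by rewrite -mulrA rmorphM rmorphXn.
split.
  under eq_fun do rewrite E (ReS _ (fun k => p`_k * C (_ ^+ k * _))).
  rewrite (ReS _ (fun k => p`_k * C (hankel_moment k nu / omega ^+ k.+1))).
  under eq_bigr do rewrite ReM; under eq_fun do (under eq_bigr do rewrite ReM).
  apply: (@is_abel_integral_sum R n (fun k => complex.Re p`_k)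
    (fun k x => x ^+ k * besselJ nu (omega * x))
    (fun k => hankel_moment k nu / omega ^+ k.+1)) => k.
  exact: abel_integral_bessel.
under eq_fun do rewrite E (ImS _ (fun k => p`_k * C (_ ^+ k * _))).
rewrite (ImS _ (fun k => p`_k * C (hankel_moment k nu / omega ^+ k.+1))).
under eq_bigr do rewrite ImM; under eq_fun do (under eq_bigr do rewrite ImM).
apply: (@is_abel_integral_sum R n (fun k => complex.Im p`_k)
  (fun k x => x ^+ k * besselJ nu (omega * x))
  (fun k => hankel_moment k nu / omega ^+ k.+1)) => k.
exact: abel_integral_bessel.
Qed.

(** The two terms have a common modulus factor and opposite angles [(k - nu) pi / 2], so their sum
    is twice a cosine. *)
Lemma sum_hnodes mu nu n (x w : 'I_n -> R) (omega : R) (j : 'I_n) k : 0 < omega -> 0 < x j ->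
  \sum_(b : bool) hweight mu nu x w j b * (hnode x j b / C omega) ^+ k =
  C (2 / pi * cos ((k%:R - nu%:R) * pi / 2) *
     (w j * x j `^ ((k%:R - (kappa mu nu)%:R) / 2)) / omega ^+ k).
Proof.
move=> omega0 xj.
pose r := w j * x j `^ (- ((kappa mu nu)%:R / 2)) / pi * Num.sqrt (x j) ^+ k / omega ^+ k.
pose th := (k%:R - nu%:R) * pi / 2 : R.
have h b : hweight mu nu x w j b * (hnode x j b / C omega) ^+ k = cis ((-1) ^+ b * th) * C r.
  rewrite /hweight /hnode imag_nodeE !exprMn cisX -fmorphV.
  have -> : C r = C (w j * x j `^ (- ((kappa mu nu)%:R / 2)) / pi) *
      C (Num.sqrt (x j)) ^+ k * C omega^-1 ^+ k.
    by rewrite -!rmorphXn -!rmorphM /r exprVn.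
  have -> : (-1) ^+ b * th = - ((-1) ^+ b * (nu%:R * pi / 2)) + k%:R * ((-1) ^+ b * (pi / 2)).
    by rewrite /th; ring.
  by rewrite cisD; ring.
rewrite big_bool !h /= expr1 expr0 mul1r mulN1r -mulrDl addrC cisDN -rmorphM; congr (C _).
rewrite /r /th.
have -> : x j `^ ((k%:R - (kappa mu nu)%:R) / 2) = Num.sqrt (x j) ^+ k * x j `^ (- ((kappa mu nu)%:R / 2)).
  rewrite -powR12_sqrt ?ltW// -powR_mulrn ?powR_ge0// -powRrM -powRD.
    by congr (_ `^ _); field.
  by apply/implyP => _; rewrite gt_eqF.
by ring.
Qed.

End hankel_quadrature.

(** * Exactness, coefficient by coefficient *)

Section exactness.
Context {R : realType}.
Notation C := (real_complex R).
Variables (mu nu n : nat) (x w : 'I_n -> R) (omega : R).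
Hypotheses (numu : (nu <= mu)%N) (omega0 : 0 < omega)
  (xw : is_gauss_rule (gauss_weight mu nu) x w).

(** The node part of the rule on [x^k], up to powers of [omega]; the same quantity is subtracted in
    [hweight0]. *)
Let node_moment (k : nat) : R := 2 / pi * cos ((k%:R - nu%:R) * pi / 2) *
  \sum_(j < n) w j * x j `^ ((k%:R - (kappa mu nu)%:R) / 2).

Let x_gt0 j : 0 < x j.
Proof. by case: xw. Qed.

Lemma gauss_node_moment k : (mu <= k)%N -> (k < 4 * n + kappa mu nu)%N ->
  node_moment k = hankel_moment k nu.
Proof.
move=> muk kn; rewrite /node_moment.
have nuk : (nu <= k)%N := leq_trans numu muk.
have [odk|evk] := boolP (odd (k - nu)).
  have -> : k = (nu + (k - nu)./2.*2.+1)%N by move: odk nuk; lia.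
  rewrite hankel_moment_odd natrD addrAC subrr add0r.
  by rewrite cos_odd_pihalf mulr0 mul0r.
have kd : k = (nu + (k - nu)./2.*2)%N by move: evk nuk; lia.
(* [kappa] has the parity of [nu], hence of [k]. If [mu - nu] is odd, then [k] differs from [mu], so
   [kappa = mu + 1 <= k]. *)
have kl : k = (kappa mu nu + 2 * ((k - kappa mu nu)./2))%N.
  by move: evk muk numu kn; rewrite /kappa; case: ifP; lia.
have ln : ((k - kappa mu nu)./2 < 2 * n)%N by lia.
have -> : cos ((k%:R - nu%:R) * pi / 2) = (-1) ^+ (k - nu)./2 :> R.
  rewrite {1}kd natrD addrAC subrr add0r -cos_mulpi; congr cos.
  by rewrite -muln2 natrM; field.
have -> : \sum_(j < n) w j * x j `^ ((k%:R - (kappa mu nu)%:R) / 2) =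
    \sum_(j < n) w j * x j ^+ (k - kappa mu nu)./2.
  apply: eq_bigr => j _; rewrite -powR_mulrn; last exact/ltW/x_gt0.
  by congr (_ * _ `^ _); rewrite {1}kl natrD addrAC subrr add0r natrM; field.
rewrite (gauss_rule_moment xw numu ln) -kl.
by rewrite [in RHS]kd hankel_moment_even -kd.
Qed.

Lemma hankel_quad_poly (p : {poly R[i]}) : (size p <= 4 * n + kappa mu nu)%N ->
  hankel_quad mu nu x w (fun z => p.[z]) omega =
  \sum_(k < mu + size p) p`_k * C (hankel_moment k nu / omega ^+ k.+1).
Proof.
move=> pn; rewrite /hankel_quad.
have o0 : omega != 0 by rewrite gt_eqF.
have pN : (size p <= mu + size p)%N by exact: leq_addl.
have -> : \sum_(j < n) \sum_(b : bool) hweight mu nu x w j b * p.[hnode x j b / C omega] =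
    \sum_(k < mu + size p) p`_k * C (node_moment k / omega ^+ k).
  under eq_bigr => j _ do under eq_bigr => b _ do rewrite (horner_coef_wide _ pN) mulr_sumr.
  under eq_bigr => j _ do rewrite exchange_big/=.
  rewrite exchange_big/=; apply: eq_bigr => k _.
  under eq_bigr => j _ do under eq_bigr => b _ do rewrite mulrCA.
  under eq_bigr => j _ do rewrite -mulr_sumr (sum_hnodes _ _ _ _ omega0 (x_gt0 j)).
  rewrite -mulr_sumr -rmorph_sum; congr (_ * C _).
  by rewrite /node_moment mulr_sumr mulr_suml.
under eq_bigr => k _ do rewrite derive1n_horner0.
(* [p] may have fewer than [mu] coefficients, so both sums are brought to the common range
   [mu + size p]. *)
rewrite (big_ord_widen _ (fun k => C (hweight0 mu nu x w k / omega ^+ k) * (k`!%:R * p`_k)) (leq_addr (size p) mu)).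
rewrite big_mkcond -big_split/= mulr_sumr; apply: eq_bigr => k _.
have ok : omega ^+ k != 0 by rewrite expf_neq0.
case: ltnP => kmu.
  (* For [k < mu], the subtracted term of [hweight0] cancels the node part and leaves the Gamma
     quotient. *)
  rewrite (_ : C _ * (_ * _) = p`_k * C (k`!%:R * hweight0 mu nu x w k / omega ^+ k)); last first.
    by rewrite -[k`!%:R * _ / _]mulrA [C (_ * (_ / _))]rmorphM rmorph_nat; ring.
  rewrite -mulrDr -rmorphD mulrCA -fmorphV -rmorphM; congr (_ * C _).
  have fk : k`!%:R != 0 :> R by rewrite pnatr_eq0 -lt0n fact_gt0.
  rewrite /hweight0 mulVKf// -hankel_momentE.
  rewrite -/(node_moment k) -mulrDl subrK exprS invfM.
  by ring.
(* For [mu <= k], the node part alone gives the moment; indices past the degree have coefficient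
   0. *)
rewrite add0r; have [kp|kp] := ltnP k (size p); last by rewrite nth_default// !mul0r mulr0.
rewrite gauss_node_moment//; last exact: leq_trans pn.
rewrite mulrCA -fmorphV -rmorphM; congr (_ * C _).
by rewrite exprS invfM; ring.
Qed.

Lemma hankel_quad_exact (p : {poly R[i]}) : (size p <= 4 * n + kappa mu nu)%N ->
  is_hankel_transform nu (fun z => p.[z]) omega
    (hankel_quad mu nu x w (fun z => p.[z]) omega).
Proof.
move=> pn; rewrite hankel_quad_poly//; apply: is_hankel_transform_poly => //.
exact: leq_addl.
Qed.

End exactness.

Theorem theorem3p2 (R : realType) (mu nu n : nat) (omega : R)
    (x w : 'I_n -> R) (hmunu : (nu <= mu)%N) (hn : (1 <= n)%N)
    (homega : 0 < omega)
    (hxw : is_gauss_rule (gauss_weight mu nu) x w) :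
  (~~ odd (mu - nu) ->
     forall p : {poly R[i]}, (size p <= (4 * n + mu - 1).+1)%N ->
       is_hankel_transform nu (fun z => p.[z]) omega
         (hankel_quad mu nu x w (fun z => p.[z]) omega)) /\
  (odd (mu - nu) ->
     forall p : {poly R[i]}, (size p <= (4 * n + mu).+1)%N ->
       is_hankel_transform nu (fun z => p.[z]) omega
         (hankel_quad mu nu x w (fun z => p.[z]) omega)).
Proof.
(* In both cases the size bound is [4n + kappa]: the even one since [1 <= n] keeps the truncated
   subtraction exact, the odd one since [kappa = mu + 1]. *)
split=> par p hp; apply: hankel_quad_exact => //; apply: leq_trans hp _.
  by rewrite /kappa (negbTE par); lia.
by rewrite /kappa par; lia.
Qed.
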